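(* Let $k,\ell,n,n_1,n_2$ be positive integers and let $$J(t,q,y):=\begin{pmatrix}\mathsf A(q)&a(t,y)\mathsf B(t,y)\\ \mathsf C(q)&\mathsf D(t,q,y)\end{pmatrix},\qquad J:\mathbb R_{\ge0}\times\mathbb R^\ell\times\mathbb R^k\to\mathbb R^{(n_1+n_2)\times(n_1+n_2)},$$ where $\mathsf A\in C^0(\mathbb R^\ell;\mathbb R^{n_1\times n_1})$, $\mathsf C\in C^0(\mathbb R^\ell;\mathbb R^{n_2\times n_1})$, $a\in C^1(\mathbb R_{\ge0}\times\mathbb R^k;\mathbb R)$, $\mathsf B\in C^1(\mathbb R_{\ge0}\times\mathbb R^k;\mathbb R^{n_1\times n_2})$ and $\mathsf D\in C^0(\mathbb R_{\ge0}\times\mathbb R^\ell\times\mathbb R^k;\mathbb R^{n_2\times n_2})$. Let $U,W\subset\mathbb R^n$ be nonempty with $U\cap W\ne\emptyset$ and let $\Omega(\mathbb R_{\ge0},U)$ be a nonempty set of functions $y=y_{t_0,x_0}:[t_0,\infty)\to\mathbb R^k$ parameterized by $(t_0,x_0)\in\mathbb R_{\ge0}\times U$. Assume: (1) There exist constants $L>1$ and $E>0$ such that for every $t_0\ge0$ there exists a set-valued map $[t_0,\infty)\ni t\mapsto Q(t)\subset\mathbb R^\ell$ satisfying the CP such that for every $\bar t_0\ge t_0$, $\tau_0>0$ and $y\in\Omega(\mathbb R_{\ge0},U)\cap C^0([t_0,\infty);\mathbb R^k)$ there exist a time-varying symmetric matrix $P\in C^1([\bar t_0,\infty);\mathbb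 R^{n_2\times n_2})$ and a function $d\in C^0([\bar t_0,\infty);\mathbb R)$, both $\tau_0$-noncausal with respect to $\Omega(\mathbb R_{\ge0},U)$, with $$P(t)\ge I_{n_2\times n_2}\ \ \forall t\ge\bar t_0,\qquad|P(\bar t_0)|\le L,$$ $$\int_{\bar t_0}^td(s)\,ds>-E\ \ \forall t\ge\bar t_0,\qquad\int_{\bar t_0}^\infty d(s)\,ds=\infty,$$ and, provided that $y\in\Omega(\mathbb R_{\ge0},U\cap W)\cap C^0([t_0,\infty);\mathbb R^k)$, $$e'P(t)\mathsf D(t,q,y(t))e+\tfrac12e'\dot P(t)e\le-d(t)e'P(t)e\quad\forall t\ge\bar t_0,\ e\in\ker\mathsf B(t,y(t)),\ q\in Q(t).$$ (2) For every $t_0\ge0$ and $y\in\Omega(\mathbb R_{\ge0},U)\cap C^0([t_0,\infty);\mathbb R^k)$ it holds $a(t,y(t))\ne0$ for a.e. $t\ge t_0$. Then for every $\varepsilon>0$, $\bar t_0\ge t_0\ge0$, $\tau>0$ and $y\in\Omega(\mathbb R_{\ge0},U)\cap C^0([t_0,\infty);\mathbb R^k)$ there exist time-varying matrices $S\in C^1([\bar t_0,\infty);\mathbb R^{n_1\times n_2})$, $T\in C^1([\bar t_0,\infty);\mathbb R^{n_1\times n_1})$ and a function $\bar d\in C^0([\bar t_0,\infty);\mathbb R)$, all $\tau$-noncausal with respect to $\Omega(\mathbb R_{\ge0},U)$, such that, with $$\bar P:=\begin{pmatrix}T&S\\ S'&P\end{pmatrix}\in C^1([\bar t_0,\infty);\mathbb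 R^{(n_1+n_2)\times(n_1+n_2)}),$$ $P$ being the matrix provided by (1) for $t_0,\bar t_0,y$ and some $\tau_0\in(0,\tau)$, the following hold: $$\bar P(t)\ge I_{(n_1+n_2)\times(n_1+n_2)}\ \ \forall t\ge\bar t_0,\qquad|\bar P(\bar t_0)|\le L,$$ $$\int_{\bar t_0}^t\bar d(s)\,ds>-(E+\varepsilon)\ \ \forall t\ge\bar t_0,\qquad\int_{\bar t_0}^\infty\bar d(s)\,ds=\infty,$$ and, provided that $y\in\Omega(\mathbb R_{\ge0},U\cap W)\cap C^0([t_0,\infty);\mathbb R^k)$, $$(0,e')\bar P(t)J(t,q,y(t))\begin{pmatrix}0\\ e\end{pmatrix}+\tfrac12(0,e')\dot{\bar P}(t)\begin{pmatrix}0\\ e\end{pmatrix}\le-\bar d(t)(0,e')\bar P(t)\begin{pmatrix}0\\ e\end{pmatrix}\quad\forall t\ge\bar t_0,\ e\in\mathbb R^{n_2},\ q\in Q(t).$$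
   Context: Notation: $|x|$ is the Euclidean norm, $|A|=\max\{|Ax|:|x|=1\}$ the induced matrix norm, $A'$ the transpose; matrix inequalities are in the sense of quadratic forms. $\Omega(\mathbb R_{\ge0},U\cap W)$ denotes the set of those $y_{t_0,x_0}\in\Omega(\mathbb R_{\ge0},U)$ with $x_0\in U\cap W$. CP (Compactness Property): a set-valued map $[t_0,\infty)\ni t\mapsto Q(t)\subset\mathbb R^\ell$ satisfies the CP if for every sequence $t_\nu\to t$ in $[t_0,\infty)$ and $q_\nu\in Q(t_\nu)$ there are a subsequence $(q_{\nu_k})$ and $q\in Q(t)$ with $q_{\nu_k}\to q$. Causality: let $0\le\tau\le\infty$. An object $a_{t_0,y}$ (a function of time $t$ in a subinterval of $[t_0,\infty)$, possibly depending on further fixed parameters) assigned to each $y\in\Omega(\mathbb R_{\ge0},U)\cap C^0([t_0,\infty);\mathbb R^k)$ is $\tau$-noncausal with respect to $\Omega(\mathbb R_{\ge0},U)$ if its value at time $t$ depends only on the values $y(s)$, $t_0\le s\le t+\tau$, of $y$. When, for every $y$, existence of a $\tau$-noncausal object is asserted, the objects are understood as such a family indexed by $y$.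
   Formalization: The block P of the matrix P̄ is some matrix having all the properties required in (1) (same L, E, Q, some τ0 in (0,τ)), not an arbitrary given one; for a given P the claim fails, e.g. n1=n2=1, A=C=0, a=B=1, D=5, P=d=1. *)

(* Defs.v *)
From HB Require Import structures.
From mathcomp Require Export all_boot all_order all_algebra.
From mathcomp Require Export all_classical all_reals all_analysis.

Set Implicit Arguments.
Unset Strict Implicit.
Unset Printing Implicit Defensive.

Import Order.TTheory GRing.Theory Num.Theory.
Import numFieldNormedType.Exports.

Local Open Scope classical_set_scope.
Local Open Scope ring_scope.

(* The topology on matrices is the library's (maximum norm), which is the
   Euclidean one; the Euclidean and induced norms are only needed for bounds. *)
Definition enorm (R : realType) (m : nat) (x : 'cV[R]_m) : R :=
  Num.sqrt (\sum_i x i 0 ^+ 2).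

(* For positive dimensions the supremum is a maximum. *)
Definition opnorm (R : realType) (m p : nat) (A : 'M[R]_(m, p)) : R :=
  sup [set enorm (A *m x) | x in [set x : 'cV[R]_p | enorm x = 1]].

Definition qform (R : realType) (m : nat) (A : 'M[R]_m) (x : 'cV[R]_m) : R :=
  (x^T *m A *m x) 0 0.

Definition mxge (R : realType) (m : nat) (A B : 'M[R]_m) : Prop :=
  forall x : 'cV[R]_m, qform B x <= qform A x.

(* Functions on [t0, oo) are total functions whose values before t0 are
   irrelevant, so derivatives are taken within the domain: they are two-sided
   at interior points and one-sided at t0. *)
Definition derivable_within (R : realType) (V : normedModType R) (A : set R)
    (f : R -> V) (t : R) : Prop :=
  cvg ((s - t)^-1 *: (f s - f t) @[s --> within A t^']).

Definition derive_within (R : realType) (V : normedModType R) (A : set R)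
    (f : R -> V) (t : R) : V :=
  lim ((s - t)^-1 *: (f s - f t) @[s --> within A t^']).

Definition C0_from (R : realType) (V : normedModType R) (t0 : R)
    (f : R -> V) : Prop :=
  {within `[t0, +oo[, continuous f}.

Definition C1_from (R : realType) (V : normedModType R) (t0 : R)
    (f : R -> V) : Prop :=
  (forall t, t0 <= t -> derivable_within `[t0, +oo[ f t) /\
  {within `[t0, +oo[, continuous (derive_within `[t0, +oo[ f)}.

(* C^1 on [0, oo) x R^k: all first-order partial derivatives exist and are
   jointly continuous, the one in time being one-sided at time 0. *)
Definition C1_time_output (R : realType) (k : nat) (V : normedModType R)
    (f : R -> 'cV[R]_k -> V) : Prop :=
  let H := [set z : R * 'cV[R]_k | 0 <= z.1] in
  [/\ forall z, H z -> derivable_within `[0, +oo[ (fun t => f t z.2) z.1,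
      forall z j, H z -> derivable (f z.1) z.2 (delta_mx j 0),
      {within H, continuous
         (fun z => derive_within `[0, +oo[ (fun t => f t z.2) z.1)} &
      forall j, {within H, continuous
         (fun z => 'D_(delta_mx j 0) (f z.1) z.2)}].

Definition CP (R : realType) (l : nat) (t0 : R) (Q : R -> set 'cV[R]_l) : Prop :=
  forall (u : nat -> R) (t : R) (q : nat -> 'cV[R]_l),
    (forall i, t0 <= u i) -> t0 <= t -> u @ \oo --> t ->
    (forall i, Q (u i) (q i)) ->
  exists (phi : nat -> nat) (q' : 'cV[R]_l),
    [/\ {homo phi : i j / (i < j)%N}, Q t q' & (q \o phi) @ \oo --> q'].

(* Elements of Omega(R_{>=0}, V) with initial time t0 that are continuous on
   [t0, oo); a function counts as y_{t0,x0} if it agrees with it on [t0, oo). *)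
Definition OmegaC0 (R : realType) (n k : nat)
    (yf : R -> 'cV[R]_n -> R -> 'cV[R]_k) (V : set 'cV[R]_n) (t0 : R) :
    set (R -> 'cV[R]_k) :=
  [set y | (exists2 x0, V x0 & forall t, t0 <= t -> y t = yf t0 x0 t) /\
           C0_from t0 y].

(* The object assigned to y is a function of time on [t1, oo), t1 >= t0. *)
Definition noncausal (R : realType) (k : nat) (X : Type) (t0 t1 tau : R)
    (Y : set (R -> 'cV[R]_k)) (F : (R -> 'cV[R]_k) -> R -> X) : Prop :=
  forall y1 y2, Y y1 -> Y y2 -> forall t, t1 <= t ->
    (forall s, t0 <= s <= t + tau -> y1 s = y2 s) -> F y1 t = F y2 t.

Definition int_from (R : realType) (t1 : R) (d : R -> R) (t : R) : R :=
  \int[lebesgue_measure]_(s in `[t1, t]) d s.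

(* The improper integral over [t1, oo) is the limit of the proper ones: d may
   change sign, so its Lebesgue integral need not make sense. *)
Definition gain_bounds (R : realType) (t1 E : R) (d : R -> R) : Prop :=
  (forall t, t1 <= t -> - E < int_from t1 d t) /\
  int_from t1 d @ +oo --> +oo.

(* P and d are families indexed by y; only the last clause, the decay of e' P e
   along ker B, is restricted to outputs starting in U `&` W. *)
Definition kernel_certificate (R : realType) (n k l m p : nat)
    (B : R -> 'cV[R]_k -> 'M[R]_(m, p))
    (D : R -> 'cV[R]_l -> 'cV[R]_k -> 'M[R]_p)
    (yf : R -> 'cV[R]_n -> R -> 'cV[R]_k) (U W : set 'cV[R]_n)
    (L E t0 : R) (Q : R -> set 'cV[R]_l) (t1 tau0 : R)
    (P : (R -> 'cV[R]_k) -> R -> 'M[R]_p)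
    (d : (R -> 'cV[R]_k) -> R -> R) : Prop :=
  [/\ noncausal t0 t1 tau0 (OmegaC0 yf U t0) P,
      noncausal t0 t1 tau0 (OmegaC0 yf U t0) d &
      forall y, OmegaC0 yf U t0 y ->
      [/\ C1_from t1 (P y) /\ (forall t, t1 <= t -> (P y t)^T = P y t),
          C0_from t1 (d y),
          (forall t, t1 <= t -> mxge (P y t) 1%:M) /\ opnorm (P y t1) <= L,
          gain_bounds t1 E (d y) &
          OmegaC0 yf (U `&` W) t0 y ->
          forall (t : R) (e : 'cV[R]_p) (q : 'cV[R]_l),
            t1 <= t -> B t (y t) *m e = 0 -> Q t q ->
            qform (P y t *m D t q (y t)) e
            + 2^-1 * qform (derive_within `[t1, +oo[ (P y) t) e
            <= - d y t * qform (P y t) e]].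

(* Main.v *)
(** The off-diagonal block S = - phi M, with M a C^1 approximation of
    g(t) = a(t, y(t)) B(t, y(t)) and phi >= 0 large, contributes about
    - phi a^2 |B e|^2 to the quadratic form.  By compactness (CP), the decay along
    ker B costs at most eta |e|^2 + N |B e|^2 for all e; the term N |B e|^2 is
    absorbed where phi a^2 / 2 >= N, and since a <> 0 almost everywhere the loss
    max(0, N - phi a^2 / 2) |B|^2 has an arbitrarily small integral once phi is
    large (dominated convergence).  The numbers needed on each cell
    [t1 + j h, t1 + (j + 1) h] depend on y up to a short time ahead, and are
    turned into causal C^1 functions by a sum of quadratic ramps; M is a forward
    average of g over a causal window.

    The positivity of the full matrix needs P > 1 wherever S <> 0, which the given
    P need not satisfy.  It is replaced by exp(2 b) P with b(t1) = 0 and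
    0 < b(t) < E + int d for t > t1: this is again a certificate, for d - b', and
    S(t1) = 0 because phi(t1) = 0. *)

(* The output [y] is only continuous, so [g] need not be differentiable although [a] and [B] are
   C^1; this is why an average [M] replaces it. The decay is known only for outputs starting in the
   intersection of [U] and [W], whereas the families must be defined and causal for all outputs;
   hence every number is chosen from a set that depends on [y] only up to a bounded time ahead. The
   block [T] is invisible to vectors [(0, e)], so it may be as large as positivity of the full
   matrix requires: [|S|^2] must not exceed the product of the margins of [T] and [P] over the
   identity. The guaranteed margin of [P] vanishes at [t1] to first order; a factor [t - t1] in
   [phi] makes [|S|^2] vanish to second order, so the margin demanded of [T] stays C^1 up to [t1].
   Since [P >= 1], an error [c |e|^2] is paid for by lowering the gain by [c]. The errors are
   [2 eta] and the unabsorbed part of the domination term; each has integral below [eps / 4]. *)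
Require Import Defs.
From mathcomp Require Import ring lra.

Set Implicit Arguments.
Unset Strict Implicit.
Unset Printing Implicit Defensive.

Import Order.TTheory GRing.Theory Num.Theory.
Import numFieldNormedType.Exports.

Local Open Scope classical_set_scope.
Local Open Scope ring_scope.

(** * Entrywise limits of matrices *)

Section MatrixLimits.
Context {R : realType} {T : Type} (F : set_system T) {FF : Filter F}.

Lemma cvg_mxP m p (f : T -> 'M[R]_(m, p)) (l : 'M[R]_(m, p)) :
  f @ F --> l <-> forall i j, f x i j @[x --> F] --> l i j.
Proof.
split=> [fl i j|fl].
  exact: (cvg_comp _ (fun M : 'M[R]_(m, p) => M i j) fl (@coord_continuous _ _ _ i j l)).
apply/cvg_ballP => e e0.
have fij i j : \forall x \near F, ball (l i j) e (f x i j).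
  by have /cvg_ballP/(_ _ e0) := fl i j.
have h : \forall x \near F, forall i j, ball (l i j) e (f x i j).
  apply: (filter_forall (f := fun i x => forall j, ball (l i j) e (f x i j))) => i.
  exact: (filter_forall (f := fun j x => ball (l i j) e (f x i j))).
by apply: filterS h => x; split.
Qed.

End MatrixLimits.

(** * Calculus of derivatives within a closed ray *)

Section WithinDerivative.
Context {R : realType} (t1 : R).

(** Relational form of the derivative: the rules of calculus become limit statements about one
    filter, free of the default value of [lim]. *)
Definition der_from (V : normedModType R) (f : R -> V) (t : R) (l : V) : Prop :=
  (s - t)^-1 *: (f s - f t) @[s --> within `[t1, +oo[ t^'] --> l.

(** The points [t + e / 2] lie in the ray, also for [t = t1]. Properness makes the limit unique, so
    [derive_within] can be computed. *)
#[local] Instance within_ray_proper t : infer (t1 <= t) -> ProperFilter (within `[t1, +oo[ t^').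
Proof.
move=> t1t; split; last exact: within_filter.
rewrite /within /dnbhs /within /= => /nbhs_ballP[e /= e0] /(_ (t + e / 2)).
rewrite /ball /= in_itv /= andbT opprD addrA subrr add0r normrN.
have e20 : 0 < e / 2 by rewrite divr_gt0.
rewrite gtr0_norm //; apply.
- by rewrite ltr_pdivrMr // ltr_pMr // ltr1n.
- by rewrite -subr_eq0 addrAC subrr add0r gt_eqF.
- by rewrite (le_trans t1t) // lerDl ltW.
Qed.

Lemma der_fromE (V : normedModType R) (f : R -> V) t l : t1 <= t -> der_from f t l ->
  derivable_within `[t1, +oo[ f t /\ derive_within `[t1, +oo[ f t = l.
Proof.
move=> t1t fl; split; first by apply/cvg_ex; exists l.
exact: cvg_lim.
Qed.

Lemma der_from_derive_within (V : normedModType R) (f : R -> V) t :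
  derivable_within `[t1, +oo[ f t -> der_from f t (derive_within `[t1, +oo[ f t).
Proof. by []. Qed.

Lemma C0_fromP (V : normedModType R) (f : R -> V) :
  C0_from t1 f <->
  forall t, t1 <= t -> f s @[s --> within `[t1, +oo[ (nbhs t)] --> f t.
Proof.
split => [/subspace_continuousP h t t1t|h].
  by apply: h; rewrite /= in_itv /= t1t.
by apply/subspace_continuousP => t /=; rewrite in_itv /= andbT; exact: h.
Qed.

Lemma C1_fromP (V : normedModType R) (f : R -> V) :
  C1_from t1 f <->
  exists2 g, forall t, t1 <= t -> der_from f t (g t) & C0_from t1 g.
Proof.
split=> [[df cf]|[g fg cg]].
  by exists (derive_within `[t1, +oo[ f) => // t t1t; apply/der_from_derive_within/df.
split=> [t t1t|]; first exact: (der_fromE t1t (fg _ t1t)).1.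
move/C0_fromP : cg => cg; apply/C0_fromP => t t1t.
rewrite (der_fromE t1t (fg _ t1t)).2; apply: cvg_trans (cg t t1t).
apply: near_eq_cvg; rewrite near_withinE; apply: nearW => s /=.
by rewrite in_itv /= andbT => t1s; rewrite (der_fromE t1s (fg _ t1s)).2.
Qed.

Lemma der_from_ext (V : normedModType R) (f g : R -> V) t l : t1 <= t ->
  (forall s, t1 <= s -> f s = g s) -> der_from f t l -> der_from g t l.
Proof.
move=> t1t fg; apply: cvg_trans; apply: near_eq_cvg.
rewrite near_withinE; apply: nearW => s /=.
by rewrite in_itv /= andbT => t1s; rewrite !fg.
Qed.

Lemma der_from_cvg (f : R -> R) t l : der_from f t l ->
  f s @[s --> within `[t1, +oo[ t^'] --> f t.
Proof.
move=> fl.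
have h : (s - t) * ((s - t)^-1 *: (f s - f t)) + f t @[s --> within `[t1, +oo[ t^'] --> 0 * l + f t.
  apply: cvgD; last exact: cvg_cst.
  apply: cvgM => //.
  rewrite -(subrr t); apply: cvgB; last exact: cvg_cst.
  move=> P Pt; rewrite nbhs_filterE /fmap /within /dnbhs /within /=.
  by apply: filterS Pt => s + _ _.
rewrite mul0r add0r in h; apply: cvg_trans h; apply: near_eq_cvg.
rewrite near_withinE; rewrite near_withinE; apply: nearW => s /= /negP st _.
by rewrite /GRing.scale /= mulrA divff ?mul1r ?subrK // subr_eq0; apply/negP.
Qed.

Lemma der_from_cvg_nbhs (f : R -> R) t l : der_from f t l ->
  f s @[s --> within `[t1, +oo[ (nbhs t)] --> f t.
Proof.
move=> fl; apply/cvgrPdist_lt => e e0.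
have /cvgrPdist_lt/(_ e e0) := der_from_cvg fl.
rewrite !near_withinE; apply: filterS => s h t1s.
by have [->|/h] := eqVneq s t; [rewrite subrr normr0|apply].
Qed.

Lemma der_from_C0 (f : R -> R) (g : R -> R) :
  (forall t, t1 <= t -> der_from f t (g t)) -> C0_from t1 f.
Proof.
by move=> fg; apply/C0_fromP => t t1t; exact: der_from_cvg_nbhs (fg t t1t).
Qed.

Lemma C1_from_C0 (f : R -> R) : C1_from t1 f -> C0_from t1 f.
Proof. by move/C1_fromP => [g fg _]; apply: der_from_C0 fg. Qed.

Lemma der_fromD (V : normedModType R) (f g : R -> V) t l m : t1 <= t ->
  der_from f t l -> der_from g t m -> der_from (fun s => f s + g s) t (l + m).
Proof.
move=> t1t fl gm; rewrite /der_from.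
have -> : (fun s => (s - t)^-1 *: (f s + g s - (f t + g t))) =
  (fun s => (s - t)^-1 *: (f s - f t) + (s - t)^-1 *: (g s - g t)).
  by apply/funext => s; rewrite -scalerDr opprD addrACA.
exact: cvgD.
Qed.

Lemma der_fromM (f g : R -> R) t l m : t1 <= t ->
  der_from f t l -> der_from g t m -> der_from (fun s => f s * g s) t (l * g t + f t * m).
Proof.
move=> t1t fl gm; rewrite /der_from.
have -> : (fun s => (s - t)^-1 *: (f s * g s - (f t * g t))) =
  (fun s => ((s - t)^-1 *: (f s - f t)) * g s + f t * ((s - t)^-1 *: (g s - g t))).
  by apply/funext => s; rewrite /GRing.scale /=; ring.
by apply: cvgD; apply: cvgM => //; [exact: der_from_cvg gm|exact: cvg_cst].
Qed.

Lemma der_from_cst (V : normedModType R) (v : V) t : t1 <= t -> der_from (fun=> v) t 0.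
Proof.
by move=> t1t; rewrite /der_from; under eq_fun do rewrite subrr scaler0; exact: cvg_cst.
Qed.

Lemma der_from_id t : t1 <= t -> der_from id t 1.
Proof.
move=> t1t; apply: cvg_near_cst; rewrite !near_withinE; apply: nearW => s /= st _.
by rewrite /GRing.scale /= mulVf // subr_eq0.
Qed.

(** Caratheodory's factorization of [u] avoids dividing by [f s - f t], which may vanish for [s]
    near [t]. *)
Lemma der_from_comp (u f : R -> R) t l m : t1 <= t ->
  is_derive (f t) 1 u m -> der_from f t l -> der_from (fun s => u (f s)) t (m * l).
Proof.
move=> t1t /is_derive1_caratheodory[g [ug cg <-]] fl; rewrite /der_from.
under eq_fun do rewrite ug scalerAr.
by apply: cvgM => //; apply: continuous_cvg => //; exact: der_from_cvg fl.
Qed.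

Lemma der_from_is_derive (u : R -> R) t m : t1 <= t -> is_derive t 1 u m -> der_from u t m.
Proof.
move=> t1t um; rewrite -[m]mulr1.
exact: (der_from_comp t1t um (der_from_id t1t)).
Qed.

Lemma der_fromV (f : R -> R) t l : t1 <= t -> f t != 0 -> der_from f t l ->
  der_from (fun s => (f s)^-1) t (- (f t) ^- 2 * l).
Proof.
move=> t1t ft0; apply: der_from_comp => //.
have := is_deriveV ft0 (is_derive_id (f t) (1 : R)).
by rewrite /GRing.scale /= mulr1.
Qed.

Lemma der_from_mxP m p (f : R -> 'M[R]_(m, p)) t l : t1 <= t ->
  der_from f t l <-> forall i j, der_from (fun s => f s i j) t (l i j).
Proof.
move=> t1t; rewrite /der_from cvg_mxP.
have E i j : (fun s => ((s - t)^-1 *: (f s - f t)) i j) =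
    (fun s => (s - t)^-1 *: (f s i j - f t i j)).
  by apply/funext => s; rewrite !mxE.
by split=> h i j; have := h i j; rewrite E.
Qed.

Lemma C0_mxP m p (f : R -> 'M[R]_(m, p)) :
  C0_from t1 f <-> forall i j, C0_from t1 (fun s => f s i j).
Proof.
rewrite C0_fromP; split=> [h i j|h t t1t].
  by apply/C0_fromP => t t1t; move: (h t t1t) => /cvg_mxP.
by apply/cvg_mxP => i j; have /C0_fromP := h i j; exact.
Qed.

Lemma C1_mxP m p (f : R -> 'M[R]_(m, p)) :
  C1_from t1 f <-> forall i j, C1_from t1 (fun s => f s i j).
Proof.
split=> [/C1_fromP[g fg cg] i j|h].
  apply/C1_fromP; exists (fun t => g t i j); last by move/C0_mxP : cg.
  by move=> t t1t; move: (fg t t1t) => /der_from_mxP; exact.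
have /choice[g0 g0P] : forall i, exists g : 'I_p -> R -> R, forall j,
    (forall t, t1 <= t -> der_from (fun s => f s i j) t (g j t)) /\ C0_from t1 (g j).
  move=> i; have /choice[g gP] : forall j, exists g : R -> R, 
    (forall t, t1 <= t -> der_from (fun s => f s i j) t (g t)) /\ C0_from t1 g.
    by move=> j; have /C1_fromP[g] := h i j; exists g.
  by exists g.
apply/C1_fromP; exists (fun t => \matrix_(i, j) g0 i j t).
  by move=> t t1t; apply/der_from_mxP => // i j; rewrite mxE; exact: (g0P i j).1.
apply/C0_mxP => i j; under eq_fun do rewrite mxE; exact: (g0P i j).2.
Qed.

Lemma C0_fromD (f g : R -> R) : C0_from t1 f -> C0_from t1 g -> C0_from t1 (fun s => f s + g s).
Proof.
move=> /C0_fromP cf /C0_fromP cg; apply/C0_fromP => t t1t.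
by apply: cvgD; [exact: cf|exact: cg].
Qed.

Lemma C0_fromM (f g : R -> R) : C0_from t1 f -> C0_from t1 g -> C0_from t1 (fun s => f s * g s).
Proof.
move=> /C0_fromP cf /C0_fromP cg; apply/C0_fromP => t t1t.
by apply: cvgM; [exact: cf|exact: cg].
Qed.

Lemma C0_from_cst (c : R) : C0_from t1 (fun=> c).
Proof. by apply/C0_fromP => t _; exact: cvg_cst. Qed.

Lemma C0_fromN (f : R -> R) : C0_from t1 f -> C0_from t1 (fun s => - f s).
Proof. by move=> /C0_fromP cf; apply/C0_fromP => t t1t; apply: cvgN; exact: cf. Qed.

Lemma C0_from_comp (u f : R -> R) : (forall t, t1 <= t -> {for f t, continuous u}) ->
  C0_from t1 f -> C0_from t1 (fun s => u (f s)).
Proof.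
move=> cu /C0_fromP cf; apply/C0_fromP => t t1t.
by apply: continuous_cvg; [exact: cu|exact: cf].
Qed.

Lemma C0_fromV (f : R -> R) : (forall t, t1 <= t -> f t != 0) ->
  C0_from t1 f -> C0_from t1 (fun s => (f s)^-1).
Proof.
move=> f0 /C0_fromP cf; apply/C0_fromP => t t1t.
by apply: cvgV; [exact: f0|exact: cf].
Qed.

Lemma C0_from_continuous (u : R -> R) : continuous u -> C0_from t1 u.
Proof. by move=> cu; apply: continuous_subspaceT. Qed.

Lemma C1_fromD (f g : R -> R) : C1_from t1 f -> C1_from t1 g -> C1_from t1 (fun s => f s + g s).
Proof.
move=> /C1_fromP[f' ff' cf'] /C1_fromP[g' gg' cg']; apply/C1_fromP.
exists (fun s => f' s + g' s); last exact: C0_fromD.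
by move=> t t1t; apply: der_fromD => //; [exact: ff'|exact: gg'].
Qed.

Lemma C1_fromM (f g : R -> R) : C1_from t1 f -> C1_from t1 g -> C1_from t1 (fun s => f s * g s).
Proof.
move=> cf cg; move: (cf) (cg) => /C1_fromP[f' ff' cf'] /C1_fromP[g' gg' cg'].
apply/C1_fromP; exists (fun s => f' s * g s + f s * g' s).
  by move=> t t1t; apply: der_fromM => //; [exact: ff'|exact: gg'].
by apply: C0_fromD; apply: C0_fromM => //; exact: C1_from_C0.
Qed.

Lemma C1_from_cst (V : normedModType R) (v : V) : C1_from t1 (fun=> v).
Proof.
apply/C1_fromP; exists (fun=> 0); last by apply/C0_fromP => t _; exact: cvg_cst.
by move=> t t1t; exact: der_from_cst.
Qed.

Lemma C1_from_id : C1_from t1 id.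
Proof.
apply/C1_fromP; exists (fun=> 1); last exact: C0_from_cst.
by move=> t t1t; exact: der_from_id.
Qed.

Lemma C1_fromN (f : R -> R) : C1_from t1 f -> C1_from t1 (fun s => - f s).
Proof.
move=> cf; under eq_fun do rewrite -mulN1r; apply: (C1_fromM _ cf).
exact: C1_from_cst.
Qed.

Lemma C1_fromV (f : R -> R) : (forall t, t1 <= t -> f t != 0) ->
  C1_from t1 f -> C1_from t1 (fun s => (f s)^-1).
Proof.
move=> f0 cf; move: (cf) => /C1_fromP[f' ff' cf'].
apply/C1_fromP; exists (fun s => - (f s) ^- 2 * f' s).
  by move=> t t1t; apply: der_fromV => //; [exact: f0|exact: ff'].
apply: C0_fromM => //; apply: C0_fromN; apply: C0_fromV.
  by move=> t /f0 ft; rewrite expf_neq0.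
by apply: C0_fromM; exact: C1_from_C0.
Qed.

Lemma C1_from_sum (I : Type) (r : seq I) (P : pred I) (f : I -> R -> R) :
  (forall i, P i -> C1_from t1 (f i)) -> C1_from t1 (fun s => \sum_(i <- r | P i) f i s).
Proof.
move=> cf; elim: r => [|i r ih].
  by under eq_fun do rewrite big_nil; exact: C1_from_cst.
case Pi : (P i); under eq_fun do rewrite big_cons Pi.
  by apply: (C1_fromD _ ih); exact: cf.
exact: ih.
Qed.

End WithinDerivative.

(** * Continuity of C^1 data along a continuous output *)

Section OutputContinuity.
Context {R : realType}.

Lemma mvt_bound (h h' : R -> R) (a C : R) :
  (forall u : R, `|u| <= `|a| -> is_derive u (1 : R) h (h' u)) ->
  (forall u : R, `|u| <= `|a| -> `|h' u| <= C) -> `|h a - h 0| <= C * `|a|.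
Proof.
move=> dh hC.
have ch (b c : R) : (forall u, u \in `[b, c] -> `|u| <= `|a|) ->
    {within `[b, c], continuous h}.
  move=> bc; apply: derivable_within_continuous => u /bc /dh.
  by case.
have [a0|a0] := leP 0 a.
  have sub u : u \in `[0, a] -> `|u| <= `|a|.
    by rewrite in_itv /= => /andP[u0 ua]; rewrite !ger0_norm.
  have [|c cI ->] := @MVT_segment R h h' 0 a a0 _ (ch _ _ sub).
    by move=> u /subset_itv_oo_cc /sub /dh.
  by rewrite subr0 normrM; apply: ler_wpM2r => //; exact/hC/sub.
have sub u : u \in `[a, 0] -> `|u| <= `|a|.
  by rewrite in_itv /= => /andP[ua u0]; rewrite !ler0_norm ?lerN2 // ltW.
have [|c cI E] := @MVT_segment R h h' a 0 (ltW a0) _ (ch _ _ sub).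
  by move=> u /subset_itv_oo_cc /sub /dh.
rewrite -normrN opprB E sub0r normrM normrN; apply: ler_wpM2r => //; exact/hC/sub.
Qed.

(** Move from [y0] to [x] one coordinate at a time and apply the mean value theorem to each move.
    The intermediate points stay in the ball because balls of the maximum norm are products of
    intervals. *)
Lemma coordinate_lipschitz k (g : 'cV[R]_k -> R) (g' : 'I_k -> 'cV[R]_k -> R)
    (y0 : 'cV[R]_k) (e C : R) :
  (forall x j, ball y0 e x -> is_derive x (delta_mx j 0) g (g' j x)) ->
  (forall x j, ball y0 e x -> `|g' j x| <= C) ->
  forall x, ball y0 e x -> `|g x - g y0| <= C * \sum_j `|x j 0 - y0 j 0|.
Proof.
move=> dg gC x [e0 y0x].
pose w m : 'cV[R]_k := \col_i (if (i < m)%N then x i 0 else y0 i 0).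
have step m : (m <= k)%N ->
    `|g (w m) - g y0| <= C * \sum_(j < k | (j < m)%N) `|x j 0 - y0 j 0|.
  elim: m => [_|m ih mk].
    rewrite big_pred0 // mulr0 (_ : w 0%N = y0) ?subrr ?normr0 //.
    by apply/matrixP => i j; rewrite mxE ord1.
  pose jm := Ordinal mk; pose a := x jm 0 - y0 jm 0.
  pose h u := g (w m + u *: delta_mx jm 0).
  have wS : w m.+1 = w m + a *: delta_mx jm 0.
    apply/matrixP => i j; rewrite !mxE !ord1 eqxx andbT ltnS leq_eqVlt.
    have [->|ij] := eqVneq i jm; first by rewrite /= eqxx ltnn mulr1 addrCA subrr addr0.
    rewrite mulr0 addr0; case: ltngtP => // im; case/eqP: ij; exact: val_inj.
  have inball u : `|u| <= `|a| -> ball y0 e (w m + u *: delta_mx jm 0).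
    move=> ua; split=> // i j; rewrite !mxE !ord1 eqxx andbT.
    have [->|ij] := eqVneq i jm.
      rewrite /= ltnn mulr1 /ball /= opprD addrA subrr sub0r normrN.
      by apply: le_lt_trans ua _; rewrite /a distrC; exact: y0x.
    rewrite mulr0 addr0; case: ifP => _; first exact: y0x.
    exact: ballxx.
  have dh u : `|u| <= `|a| -> is_derive u (1 : R) h (g' jm (w m + u *: delta_mx jm 0)).
    move=> /inball /(dg _ jm) [dgu <-].
    have E : (fun z : R => z^-1 *: (h (z *: 1 + u) - h u)) =
        (fun z => z^-1 *: (g (z *: delta_mx jm 0 + (w m + u *: delta_mx jm 0))
          - g (w m + u *: delta_mx jm 0))).
      apply/funext => z; rewrite /h; congr (_ *: (g _ - _)).
      by rewrite [_ *: 1]mulr1 scalerDl addrCA.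
    split; first by rewrite /derivable E.
    by rewrite /derive E.
  have := @mvt_bound h _ a C dh (fun u ua => gC _ jm (inball u ua)).
  rewrite {1}/h -wS /h scale0r addr0 => hS.
  rewrite (bigD1 jm) //= mulrDr -(subrK (g (w m)) (g (w m.+1))) -addrA.
  apply: le_trans (ler_normD _ _) _; apply: lerD => //.
  apply: le_trans (ih (ltnW mk)) _; rewrite le_eqVlt; apply/orP; left; apply/eqP.
  congr (_ * _); apply: eq_bigl => j; rewrite ltnS ltn_neqAle andbC.
  by rewrite -val_eqE.
have := step k (leqnn k); rewrite (_ : w k = x); last first.
  by apply/matrixP => i j; rewrite mxE ltn_ord ord1.
by under eq_bigl do rewrite ltn_ord.
Qed.

(** Split the increment at [f s (y t)]: the change in the output is controlled by a local bound on
    the partial derivatives, uniform in [s], and the change in time by differentiability at the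
    fixed point [y t]. *)
Lemma C0_output k (f : R -> 'cV[R]_k -> R) (g' : 'I_k -> R -> 'cV[R]_k -> R) :
  (forall t x, 0 <= t -> derivable_within `[0, +oo[ (f ^~ x) t) ->
  (forall t x j, 0 <= t -> is_derive x (delta_mx j 0) (f t) (g' j t x)) ->
  (forall j, {within [set z : R * 'cV[R]_k | 0 <= z.1],
     continuous (fun z => g' j z.1 z.2)}) ->
  forall t0 (y : R -> 'cV[R]_k), 0 <= t0 -> C0_from t0 y ->
  C0_from t0 (fun t => f t (y t)).
Proof.
move=> ft fx cg t0 y t00 /C0_fromP cy; apply/C0_fromP => t t0t.
have t_ge0 := le_trans t00 t0t.
set F := within `[t0, +oo[ (nbhs t).
have FF : Filter F by exact: within_filter.
(* The added 1 makes the bound strict at [(t, y t)], so it persists nearby by continuity of the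
   partial derivatives. *)
pose C := \sum_j `|g' j t (y t)| + 1.
have : \forall z \near within [set z : R * 'cV[R]_k | 0 <= z.1] (nbhs (t, y t)),
    forall j, `|g' j z.1 z.2| <= C.
  apply: (filter_forall (f := fun j z => `|g' j z.1 z.2| <= C)) => j.
  have /subspace_continuousP/(_ (t, y t) t_ge0) := cg j.
  move=> /cvgr_norm_le /= /(_ C); apply.
  rewrite /C (bigD1 j) //= -addrA ltrDl ltr_wpDl // sumr_ge0 //.
rewrite near_withinE => /nbhs_ballP[e /= e0 eC].
have yt : \forall s \near F, [/\ t0 <= s, ball t e s & ball (y t) e (y s)].
  have h1 : \forall s \near F, ball (y t) e (y s).
    by have /cvg_ballP/(_ e e0) := cy t t0t.
  have h2 : \forall s \near F, t0 <= s.
    by rewrite near_withinE; apply: nearW => s /=; rewrite in_itv /= andbT.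
  have h3 : \forall s \near F, ball t e s.
    by rewrite near_withinE; near=> s => _; near: s; exact: nbhsx_ballx.
  by near=> s; split; near: s.
have bnd : \forall s \near F,
    `|f s (y s) - f t (y t)| <= C * \sum_j `|y s j 0 - y t j 0| + `|f s (y t) - f t (y t)|.
  apply: filterS yt => s [t0s ts ys]; have s0 := le_trans t00 t0s.
  rewrite -(subrK (f s (y t)) (f s (y s))) -addrA.
  apply: le_trans (ler_normD _ _) _; rewrite lerD2r.
  apply: (coordinate_lipschitz (e := e) (g' := fun j => g' j s)) => //.
    by move=> x j _; exact: fx.
  by move=> x j xe; exact: (eC (s, x) (conj ts xe) s0).
have lim0 : C * (\sum_j `|y s j 0 - y t j 0|) + `|f s (y t) - f t (y t)| @[s --> F]
    --> C * (\sum_(j < k) `|y t j 0 - y t j 0|) + `|f t (y t) - f t (y t)|.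
  apply: cvgD.
    apply: cvgM; first exact: cvg_cst.
    apply: cvg_big => [|j _]; first exact: add_continuous.
    apply: cvg_norm; apply: cvgB; last exact: cvg_cst.
    by have /cvg_mxP := cy t t0t; exact.
  apply: cvg_norm; apply: cvgB; last exact: cvg_cst.
  have := der_from_cvg_nbhs (ft t (y t) t_ge0); apply: cvg_trans.
  apply: cvg_app; apply: within_subset => s /=; rewrite !in_itv /= !andbT.
  exact: le_trans.
rewrite subrr normr0 addr0 big1 in lim0; last by move=> j _; rewrite subrr normr0.
rewrite mulr0 in lim0.
apply/cvgrPdist_lt => d d0; have /cvgrPdist_lt/(_ d d0) := lim0.
move: bnd; apply: filterS2 => s b; rewrite sub0r normrN => h; rewrite distrC.
exact: le_lt_trans b (le_lt_trans (ler_norm _) h).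
Unshelve. all: by end_near. Qed.

Lemma C1_time_output_C0 k (f : R -> 'cV[R]_k -> R) : C1_time_output f ->
  forall t0 (y : R -> 'cV[R]_k), 0 <= t0 -> C0_from t0 y ->
  C0_from t0 (fun t => f t (y t)).
Proof.
move=> [ft fx _ cx]; apply: (@C0_output _ _ (fun j t x => 'D_(delta_mx j 0) (f t) x)).
- by move=> t x t0; exact: (ft (t, x)).
- by move=> t x j t0; apply/derivableP; exact: (fx (t, x)).
- exact: cx.
Qed.

Lemma C1_time_output_mx_C0 k m p (f : R -> 'cV[R]_k -> 'M[R]_(m, p)) :
  C1_time_output f ->
  forall t0 (y : R -> 'cV[R]_k), 0 <= t0 -> C0_from t0 y ->
  C0_from t0 (fun t => f t (y t)).
Proof.
move=> [ft fx _ cx] t0 y t00 cy; apply/C0_mxP => i j.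
apply: (@C0_output _ (fun t x => f t x i j)
  (fun l t x => ('D_(delta_mx l 0) (f t) x) i j)) => //.
- move=> t x t_ge0; have /der_from_derive_within/der_from_mxP h := ft (t, x) t_ge0.
  by have /der_fromE[] := h t_ge0 i j.
- move=> t x l t_ge0.
  pose q z := z^-1 *: (f t (z *: delta_mx l 0 + x) i j - f t x i j).
  have qE : q z @[z --> 0^'] --> ('D_(delta_mx l 0) (f t) x) i j.
    have /cvg_mxP/(_ i j) := fx (t, x) l t_ge0.
    by apply: cvg_trans; apply: near_eq_cvg; apply: nearW => z; rewrite /q !mxE.
  by split; [apply/cvg_ex; eexists; exact: qE|apply/cvg_lim].
- move=> l; have /subspace_continuousP h := cx l.
  by apply/subspace_continuousP => z Hz; have /cvg_mxP := h z Hz; exact.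
Qed.

End OutputContinuity.

(** * Integrals of continuous functions over a ray *)

Section IntegralFrom.
Context {R : realType}.
Notation mu := (@lebesgue_measure R).

Lemma der_from_ray_sub (V : normedModType R) (a b : R) (f : R -> V) t l :
  a <= b -> der_from a f t l -> der_from b f t l.
Proof.
move=> ab; apply: cvg_trans; apply: cvg_app; apply: within_subset => s /=.
by rewrite !in_itv /= !andbT; exact: le_trans.
Qed.

Lemma C0_ray_sub (V : normedModType R) (a b : R) (f : R -> V) :
  a <= b -> C0_from a f -> C0_from b f.
Proof.
move=> ab; apply: continuous_subspaceW => s /=.
by rewrite !in_itv /= !andbT; exact: le_trans.
Qed.

Lemma C0_itv (a b c : R) (f : R -> R) : a <= b -> C0_from a f ->
  {within `[b, c], continuous f}.
Proof.
move=> ab; apply: continuous_subspaceW => s /=.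
by rewrite !in_itv /= !andbT => /andP[+ _]; exact: le_trans.
Qed.

Lemma C0_integrable (a b c : R) (f : R -> R) : a <= b -> C0_from a f ->
  mu.-integrable `[b, c] (EFin \o f).
Proof.
move=> ab /(C0_itv ab) cf.
by apply: continuous_compact_integrable => //; exact: segment_compact.
Qed.

(** Freezing [f] at its value at [t1] before that time gives a continuous function on the whole
    line, to which two-sided results apply. *)
Lemma C0_clamp (t1 : R) (V : normedModType R) (f : R -> V) : C0_from t1 f ->
  continuous (fun t => f (Num.max t1 t)).
Proof.
move=> /C0_fromP cf t.
have cm : {for t, continuous (fun s : R => Num.max t1 s)}.
  by apply: continuous_max; [exact: cvg_cst|exact: cvg_id].
have t1m : t1 <= Num.max t1 t by rewrite le_max lexx.
move=> P /(cf _ t1m); rewrite nbhs_filterE /within /= => /cm.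
rewrite !nbhs_filterE /fmap /=; apply: filterS => s; apply.
by rewrite /= in_itv /= le_max lexx.
Qed.

Lemma der_from_interior (t1 : R) (f : R -> R) t l : t1 < t ->
  der_from t1 f t l -> is_derive t (1 : R) f l.
Proof.
move=> t1t fl; apply/is_derive1_caratheodory.
exists (fun s => if s == t then l else (s - t)^-1 * (f s - f t)); split.
- move=> s; case: eqVneq => [->|st]; first by rewrite !subrr mulr0.
  by rewrite mulrAC mulVf ?mul1r // subr_eq0.
- apply/cvgrPdist_lt => e e0; rewrite eqxx.
  have /cvgrPdist_lt/(_ e e0) := fl; rewrite !near_withinE => h.
  near=> s; case: eqVneq => [_|st]; first by rewrite subrr normr0.
  apply: (near h s) => //.
  rewrite /= in_itv /= andbT ltW //; near: s; exact: lt_nbhsr.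
- by rewrite eqxx.
Unshelve. all: by end_near. Qed.

Lemma der_from_mvt (t1 : R) (f g : R -> R) a b :
  (forall t, t1 <= t -> der_from t1 f t (g t)) -> t1 <= a -> a <= b ->
  exists2 c, a <= c <= b & f b - f a = g c * (b - a).
Proof.
move=> fg t1a ab.
have [||c cI E] := @MVT_segment R f g a b ab; last by exists c.
  move=> x; rewrite in_itv /= => /andP[ax _]; apply: (@der_from_interior t1).
    exact: le_lt_trans ax.
  by apply: fg; rewrite (le_trans t1a) // ltW.
by apply: (@C0_itv t1) => //; exact: der_from_C0 fg.
Qed.

(** The fundamental theorem is applied at an interior point: starting the integral of the clamped
    function at [t1 - 1] makes [t = t1] interior too. *)
Lemma int_from_wder (t1 : R) (g : R -> R) t : C0_from t1 g -> t1 <= t ->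
  der_from t1 (int_from t1 g) t (g t).
Proof.
move=> cg t1t; pose h s := g (Num.max t1 s).
have ch : continuous h by exact: C0_clamp.
have hi a b : mu.-integrable `[a, b] (EFin \o h).
  apply: (@C0_integrable a) => //; exact: C0_from_continuous.
pose G s := \int[mu]_(x in `[t1 - 1, s]) h x.
have t11 : t1 - 1 < t1 by rewrite ltrBlDr ltrDl.
have tt1 : t < t + 1 by rewrite ltrDl.
have dG : is_derive t (1 : R) G (g t).
  rewrite (_ : g t = h t); last by rewrite /h max_r.
  have [dG E] := @continuous_FTC1_closed R h (t1 - 1) t (t + 1) tt1 (hi _ _)
    (lt_le_trans t11 t1t) (ch t).
  by split; [exact: dG|rewrite -derive1E].
apply: (@der_from_ext _ _ _ (fun s => G s + - G t1)) => //.
  move=> s t1s.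
  rewrite /G (@Rintegral_itvB _ h (BLeft (t1 - 1)) (BRight s) t1) ?bnd_simp //; last exact: ltW.
  rewrite Rintegral_itv_obnd_cbnd; last first.
    by apply: integrableS (hi t1 s) => //; exact: subset_itv_oc_cc.
  apply: eq_Rintegral => x; rewrite inE /= in_itv /= => /andP[t1x _].
  by rewrite /h max_r.
rewrite -[g t]addr0; apply: der_fromD => //; first exact: der_from_is_derive.
exact: der_from_cst.
Qed.

Lemma int_from_id (t1 : R) (g : R -> R) : int_from t1 g t1 = 0.
Proof. by rewrite /int_from set_itv1 Rintegral_set1. Qed.

(** [F] minus the integral has zero derivative, hence is constant by the mean value theorem. *)
Lemma int_from_primitive (t1 : R) (F f : R -> R) :
  (forall t, t1 <= t -> der_from t1 F t (f t)) -> C0_from t1 f ->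
  forall t, t1 <= t -> int_from t1 f t = F t - F t1.
Proof.
move=> Ff cf t t1t.
have d0 s : t1 <= s -> der_from t1 (fun s => F s + -1 * int_from t1 f s) s 0.
  move=> t1s; rewrite -(subrr (f s)) -[- f s]mulN1r.
  apply: der_fromD => //; first exact: Ff.
  rewrite -[_ * f s]add0r -[in X in X + _](mul0r (int_from t1 f s)).
  by apply: der_fromM => //; [exact: der_from_cst|exact: int_from_wder].
have [c _] := der_from_mvt d0 (lexx t1) t1t.
rewrite mul0r int_from_id => E; lra.
Qed.

Lemma int_fromB (t1 a : R) (g : R -> R) t : C0_from t1 g -> t1 <= a -> a <= t ->
  int_from a g t = int_from t1 g t - int_from t1 g a.
Proof.
move=> cg t1a ait; apply: int_from_primitive => //; last exact: C0_ray_sub cg.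
move=> s ais; apply: (der_from_ray_sub t1a); apply: int_from_wder => //.
exact: le_trans t1a ais.
Qed.

Lemma int_fromD (t1 : R) (f g : R -> R) t : C0_from t1 f -> C0_from t1 g ->
  t1 <= t -> int_from t1 (fun s => f s + g s) t = int_from t1 f t + int_from t1 g t.
Proof.
move=> cf cg t1t.
rewrite (@int_from_primitive t1 (fun s => int_from t1 f s + int_from t1 g s)) //.
- by rewrite !int_from_id addr0 subr0.
- by move=> s t1s; apply: der_fromD => //; exact: int_from_wder.
- exact: C0_fromD.
Qed.

Lemma int_fromN (t1 : R) (f : R -> R) t : C0_from t1 f -> t1 <= t ->
  int_from t1 (fun s => - f s) t = - int_from t1 f t.
Proof.
move=> cf t1t; apply/eqP; rewrite -addr_eq0 -int_fromD //; last exact: C0_fromN.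
by under eq_fun do rewrite addNr; rewrite /int_from Rintegral_cst // mul0r.
Qed.

Lemma int_from_le (t1 : R) (f g : R -> R) t : C0_from t1 f -> C0_from t1 g ->
  t1 <= t -> (forall s, t1 <= s <= t -> f s <= g s) ->
  int_from t1 f t <= int_from t1 g t.
Proof.
move=> cf cg t1t fg; apply: le_Rintegral => [|||s] /=.
- exact: measurable_itv.
- exact: (C0_integrable _ (lexx t1)).
- exact: (C0_integrable _ (lexx t1)).
- by rewrite in_itv /=; exact: fg.
Qed.

Lemma int_from_ge0 (t1 : R) (f : R -> R) t : 
  (forall s, t1 <= s <= t -> 0 <= f s) -> 0 <= int_from t1 f t.
Proof. by move=> f0; apply: Rintegral_ge0 => s /=; rewrite in_itv /=; exact: f0. Qed.

End IntegralFrom.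

(** * Making the unabsorbed term small in the mean *)

Section Absorption.
Context {R : realType}.
Notation mu := (@lebesgue_measure R).

Lemma C0_from_pos (t1 : R) (f : R -> R) :
  C0_from t1 f -> C0_from t1 (fun s => Num.max 0 (f s)).
Proof.
move=> cf; apply: (@C0_from_comp _ _ (fun x => Num.max 0 x)) => // t _.
by apply: continuous_max; [exact: cvg_cst|exact: cvg_id].
Qed.

(** Along [v = n] the integrand is eventually zero wherever [al > 0], and it never exceeds
    [|N| w]. *)
Lemma int_from_absorb (a b : R) (N al w : R -> R) (e : R) :
  C0_from a N -> C0_from a al -> C0_from a w ->
  (forall t, a <= t -> 0 <= al t) -> (forall t, 0 <= w t) ->
  {ae mu, forall t, a <= t -> al t != 0} -> 0 < e ->
  exists2 v, 0 <= v & int_from a (fun t => Num.max 0 (N t - v * al t) * w t) b < e.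
Proof.
move=> cN cal cw al0 w0 ae_al e0.
pose f (v t : R) : R := Num.max 0 (N t - v * al t) * w t.
have cf v : C0_from a (f v).
  apply: C0_fromM => //; apply: C0_from_pos; apply: C0_fromD => //.
  by apply: C0_fromN; apply: C0_fromM => //; exact: C0_from_cst.
have cg : C0_from a (fun t => `|N t| * w t).
  apply: C0_fromM => //; apply: (@C0_from_comp _ _ (fun x => `|x|)) => // t _.
  exact: norm_continuous.
have [] := @dominated_convergence _ _ _ mu `[a, b] _ (fun n => EFin \o f n%:R)
  (fun=> 0%:E) (EFin \o (fun t => `|N t| * w t)) _ _ _ (C0_integrable b (lexx a) cg) _.
- exact: measurable_itv.
- by move=> n; have /integrableP[] := C0_integrable b (lexx a) (cf n%:R).
- exact: measurable_cst.
- apply: (@filterS _ _ (ae_filter_ringOfSetsType mu)) ae_al => t alt0.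
  rewrite /= in_itv /= => /andP[ta _].
  have {}alt0 : 0 < al t by rewrite lt_neqAle eq_sym alt0 //= al0.
  apply: cvg_near_cst; exists (Num.bound (N t / al t)) => // n /= nN.
  rewrite /f max_l ?mul0r //; rewrite subr_le0 -ler_pdivrMr //.
  apply: le_trans (ler_norm _) (ltW (lt_le_trans (archi_boundP _) _)) => //.
  rewrite ler_nat; apply: leq_trans nN.
  by rewrite /Num.bound normr_id.
- apply: aeW => t n; rewrite /= in_itv /= => /andP[ta _].
  rewrite lee_fin normrM (ger0_norm (w0 t)) ler_wpM2r //.
  rewrite ger0_norm ?le_max ?lexx // ge_max normr_ge0 /=.
  apply: le_trans (ler_norm _); rewrite gerBl; apply: mulr_ge0 => //; exact: al0.
move=> _ _; rewrite integral0 => /fine_cvgP[_] /cvgr_lt /= /(_ e e0) [n _ /(_ n (leqnn n))].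
by exists n%:R.
Qed.

End Absorption.

(** * Causal C^1 majorants built from quadratic ramps *)

Section Majorant.
Context {R : realType}.

(** The square makes the positive part C^1 at 0; the function is zero up to 0 and at least 1 from 1
    on. *)
Definition ramp (x : R) : R := Num.max 0 x ^+ 2.

Lemma is_derive_ramp (x : R) : is_derive x (1 : R) ramp (2 * Num.max 0 x).
Proof.
(* One quadratic remainder estimate serves all sign cases; when [z] and [x] have opposite signs it
   rests on [z x <= 0]. *)
have bnd z : `|ramp z - ramp x - 2 * Num.max 0 x * (z - x)| <= (z - x) ^+ 2.
  have := sqr_ge0 (z - x); have := sqr_ge0 z; have := sqr_ge0 x.
  rewrite /ramp ler_norml; case: (leP 0 z) => z0; case: (leP 0 x) => x0 sx sz szx.
  - by apply/andP; split; nra.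
  - have zx : 0 <= z * - x by rewrite mulr_ge0 // oppr_ge0 ltW.
    by apply/andP; split; nra.
  - have zx : 0 <= - z * x by rewrite mulr_ge0 // oppr_ge0 ltW.
    by apply/andP; split; nra.
  - by apply/andP; split; nra.
apply/is_derive1_caratheodory.
exists (fun z => if z == x then 2 * Num.max 0 x else (ramp z - ramp x) / (z - x)).
split; last by rewrite eqxx.
- move=> z; case: eqVneq => [->|zx]; first by rewrite !subrr mulr0.
  by rewrite divfK // subr_eq0.
- apply/cvgrPdist_le => e e0; rewrite eqxx; near=> z.
  case: eqVneq => [_|zx]; first by rewrite subrr normr0 ltW.
  have zx0 : 0 < `|z - x| by rewrite normr_gt0 subr_eq0.
  rewrite distrC; apply: (@le_trans _ _ `|z - x|); last first.
    by rewrite distrC ltW //; near: z; apply: (@nbhsx_ballx _ R).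
  rewrite -(ler_pM2r zx0) -normrM mulrBl divfK ?subr_eq0 // -normrM -expr2.
  by apply: le_trans (bnd z) _; exact: ler_norm.
Unshelve. all: by end_near. Qed.

Lemma C1_ramp (t1 : R) (f : R -> R) : C1_from t1 f -> C1_from t1 (fun t => ramp (f t)).
Proof.
move=> cf; have /C1_fromP[g fg cg] := cf; apply/C1_fromP.
exists (fun t => 2 * Num.max 0 (f t) * g t).
  by move=> t t1t; apply: der_from_comp (fg t t1t) => //; exact: is_derive_ramp.
apply: C0_fromM => //; apply: C0_fromM; first exact: C0_from_cst.
by apply: C0_from_pos; exact: C1_from_C0.
Qed.

Lemma der_from_near_ext (V : normedModType R) (t1 T : R) (f g : R -> V) t l : t1 <= t -> t < T ->
  (forall s, t1 <= s -> s < T -> f s = g s) -> der_from t1 f t l -> der_from t1 g t l.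
Proof.
move=> t1t tT fg; apply: cvg_trans; apply: near_eq_cvg.
rewrite !near_withinE; near=> s => _ /=; rewrite in_itv /= andbT => t1s.
by rewrite !fg //; near: s; exact: lt_nbhsl.
Unshelve. all: by end_near. Qed.

(** Needed because the number of terms of [ramp_sum] varies with [t]: only on bounded time intervals
    is it one fixed finite sum. *)
Lemma C1_from_local (t1 : R) (f : R -> R) :
  (forall T, exists2 g, C1_from t1 g & forall t, t1 <= t -> t < T -> f t = g t) ->
  C1_from t1 f.
Proof.
move=> loc.
have dloc T g : C1_from t1 g -> (forall t, t1 <= t -> t < T -> f t = g t) ->
    forall t, t1 <= t -> t < T -> derivable_within `[t1, +oo[ f t /\
      derive_within `[t1, +oo[ f t = derive_within `[t1, +oo[ g t.
  move=> [dg _] fg t t1t tT; apply: der_fromE => //; apply: (@der_from_near_ext _ _ T g) => //.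
    by move=> s t1s sT; rewrite fg.
  by apply: der_from_derive_within; exact: dg.
have tS (t : R) : t < t + 1 by rewrite ltrDl.
split=> [t t1t|].
  by have [g cg fg] := loc (t + 1); have [] := dloc _ _ cg fg t t1t (tS t).
apply/C0_fromP => t t1t; have [g cg fg] := loc (t + 1).
have D := dloc _ _ cg fg; rewrite (D t t1t (tS t)).2.
have /C0_fromP/(_ t t1t) := cg.2; apply: cvg_trans; apply: near_eq_cvg.
rewrite near_withinE; near=> s; rewrite /= in_itv /= andbT => t1s.
by rewrite (D s t1s _).2 //; near: s; exact: lt_nbhsl.
Unshelve. all: by end_near. Qed.

Variables (t1 h : R) (h0 : 0 < h).

(** The term of [v i] starts one cell before the node [t1 + i h], has reached weight 1 at the node
    and never decreases. Thus the value at [t] involves only nodes up to [t + h], and the omitted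
    terms, with [i > x + 1], are zero. *)
Definition ramp_sum (v : nat -> R) (t : R) : R :=
  let x := (t - t1) / h in
  \sum_(i < (Num.bound x).+1) v i * ramp (x - i%:R + 1).

Let ramp0 (x : R) : x <= 0 -> ramp x = 0.
Proof. by move=> x0; rewrite /ramp max_l // expr0n. Qed.

Let sum_stable (v : nat -> R) (x : R) m m' : x + 1 <= m%:R -> (m <= m')%N ->
  \sum_(i < m') v i * ramp (x - i%:R + 1) = \sum_(i < m) v i * ramp (x - i%:R + 1).
Proof.
move=> xm mm'; rewrite -!(big_mkord xpredT (fun i => v i * ramp (x - i%:R + 1))).
rewrite (big_cat_nat _ mm') //= [X in _ + X]big1_seq ?addr0 // => i.
rewrite mem_index_iota => /= /andP[mi _]; rewrite ramp0 ?mulr0 //.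
have : m%:R <= i%:R :> R by rewrite ler_nat.
lra.
Qed.

Lemma ramp_sumE (v : nat -> R) (t : R) m : t1 <= t -> (t - t1) / h + 1 <= m%:R ->
  ramp_sum v t = \sum_(i < m) v i * ramp ((t - t1) / h - i%:R + 1).
Proof.
move=> t1t xm; rewrite /ramp_sum; set x := (t - t1) / h in xm *.
have x0 : 0 <= x by rewrite /x divr_ge0 ?subr_ge0 // ltW.
have xb : x + 1 <= (Num.bound x).+1%:R.
  by rewrite -natr1 lerD2r ltW // archi_boundP.
have [le|/ltnW le] := leqP m (Num.bound x).+1; first exact: sum_stable.
by apply/esym; exact: sum_stable.
Qed.

Lemma C1_ramp_sum (v : nat -> R) : C1_from t1 (ramp_sum v).
Proof.
apply: C1_from_local => T.
pose m := (Num.bound ((T - t1) / h)).+1.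
exists (fun t => \sum_(i < m) v i * ramp ((t - t1) / h - i%:R + 1)).
  apply: C1_from_sum => i _; apply: C1_fromM; first exact: C1_from_cst.
  apply: C1_ramp; do 2 (apply: C1_fromD; last exact: C1_from_cst).
  apply: C1_fromM; last exact: C1_from_cst.
  by apply: C1_fromD; [exact: C1_from_id|exact: C1_from_cst].
move=> t t1t tT; apply: ramp_sumE => //.
rewrite /m -natr1 lerD2r ltW //; apply: le_lt_trans (archi_boundP _).
  by rewrite ler_pM2r ?invr_gt0 // lerD2r ltW.
by rewrite divr_ge0 ?ltW // subr_gt0 (le_lt_trans t1t).
Qed.

Lemma ramp_sum_ge (v : nat -> R) (t : R) j : (forall i, 0 <= v i) ->
  t1 + j%:R * h <= t -> v j <= ramp_sum v t.
Proof.
move=> v0 jt.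
have t1t : t1 <= t by apply: le_trans jt; rewrite lerDl mulr_ge0 // ltW.
pose x := (t - t1) / h.
have x0 : 0 <= x by rewrite /x divr_ge0 ?subr_ge0 // ltW.
have jx : j%:R <= x by rewrite /x ler_pdivlMr // lerBrDl.
have jb : (j < (Num.bound x).+1)%N.
  by rewrite ltnS ltnW // -(ltr_nat R); apply: le_lt_trans jx (archi_boundP x0).
rewrite /ramp_sum -/x (bigD1 (Ordinal jb)) //= -[leLHS]addr0; apply: lerD.
  rewrite ler_peMr // /ramp max_r; last by lra.
  by rewrite expr2; nra.
by apply: sumr_ge0 => i _; rewrite mulr_ge0 // /ramp sqr_ge0.
Qed.

Lemma ramp_sum_local (v1 v2 : nat -> R) (t : R) : t1 <= t ->
  (forall i, t1 + i%:R * h <= t + h -> v1 i = v2 i) -> ramp_sum v1 t = ramp_sum v2 t.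
Proof.
move=> t1t v12; rewrite /ramp_sum; apply: eq_bigr => i _.
have [it|it] := leP (t1 + i%:R * h) (t + h); first by rewrite v12.
rewrite ramp0 ?mulr0 //.
suff : (t - t1) / h < i%:R - 1 by lra.
by rewrite ltr_pdivrMr //; lra.
Qed.

(** The choice by [xget] depends on [y] only through the set of admissible values: outputs agreeing
    up to [sg] after node [j] have equal sets, hence get the same number. The ramps start [h] early,
    which adds [h] to the anticipation. *)
Lemma causal_majorant k (Y : set (R -> 'cV[R]_k)) (t0 sg : R)
    (G : (R -> 'cV[R]_k) -> nat -> R -> Prop) :
  (forall y, Y y -> forall j, exists2 v, 0 <= v & G y j v) ->
  (forall y1 y2, Y y1 -> Y y2 -> forall j,
     (forall s, t0 <= s <= t1 + j%:R * h + sg -> y1 s = y2 s) ->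
     forall v, G y1 j v -> G y2 j v) ->
  exists V : (R -> 'cV[R]_k) -> R -> R,
    noncausal t0 t1 (sg + h) Y V /\
    forall y, Y y -> C1_from t1 (V y) /\
      forall j, exists v, [/\ 0 <= v, G y j v &
        forall t, t1 + j%:R * h <= t -> v <= V y t].
Proof.
move=> exG cG.
pose v y j := xget 0 [set v | 0 <= v /\ G y j v].
have vP y : Y y -> forall j, 0 <= v y j /\ G y j (v y j).
  move=> Yy j; rewrite /v; case: xgetP => [x -> //|/= no].
  by have [w w0 Gw] := exG y Yy j; case: (no w).
exists (fun y => ramp_sum (v y)); split.
  move=> y1 y2 Y1 Y2 t t1t y12; apply: ramp_sum_local => // i it.
  rewrite /v; congr (xget _ _); apply/seteqP; split=> w /= [w0 Gw]; split=> //.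
    apply: cG Gw => // s /andP[t0s st]; apply: y12; rewrite t0s /=.
    by apply: le_trans st _; lra.
  apply: cG Gw => // s /andP[t0s st]; apply/esym/y12; rewrite t0s /=.
  by apply: le_trans st _; lra.
move=> y Yy; split=> [|j]; first exact: C1_ramp_sum.
exists (v y j); have [v0 Gv] := vP y Yy j; split=> // t jt.
by apply: ramp_sum_ge => // i; case: (vP y Yy i).
Qed.

End Majorant.

(** * Quadratic forms, Frobenius bounds and block positivity *)

Section QuadraticForms.
Context {R : realType}.

Definition sqn m (x : 'cV[R]_m) : R := \sum_i x i 0 ^+ 2.

Definition dotv m (x y : 'cV[R]_m) : R := \sum_i x i 0 * y i 0.

(** The squared Frobenius norm: it dominates the squared induced norm and, being polynomial in the
    entries, is C^1 along C^1 matrices. *)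
Definition fro2 m p (A : 'M[R]_(m, p)) : R := \sum_i \sum_j A i j ^+ 2.

Lemma sqn_ge0 m (x : 'cV[R]_m) : 0 <= sqn x.
Proof. by apply: sumr_ge0 => i _; exact: sqr_ge0. Qed.

Lemma fro2_ge0 m p (A : 'M[R]_(m, p)) : 0 <= fro2 A.
Proof. by do 2 (apply: sumr_ge0 => ? _); exact: sqr_ge0. Qed.

Lemma sqnZ m (a : R) (x : 'cV[R]_m) : sqn (a *: x) = a ^+ 2 * sqn x.
Proof. by rewrite /sqn mulr_sumr; apply: eq_bigr => i _; rewrite mxE exprMn. Qed.

Lemma sqnD m (x y : 'cV[R]_m) : sqn (x + y) = sqn x + 2 * dotv x y + sqn y.
Proof.
rewrite /sqn /dotv mulr_sumr -!big_split /=; apply: eq_bigr => i _.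
by rewrite mxE; ring.
Qed.

Lemma dotvZl m (a : R) (x y : 'cV[R]_m) : dotv (a *: x) y = a * dotv x y.
Proof. by rewrite /dotv mulr_sumr; apply: eq_bigr => i _; rewrite mxE mulrA. Qed.

Lemma dotvZr m (a : R) (x y : 'cV[R]_m) : dotv x (a *: y) = a * dotv x y.
Proof. by rewrite /dotv mulr_sumr; apply: eq_bigr => i _; rewrite mxE mulrCA. Qed.

Lemma dotvE m (x y : 'cV[R]_m) : (x^T *m y) 0 0 = dotv x y.
Proof. by rewrite mxE; apply: eq_bigr => i _; rewrite mxE. Qed.

Lemma dotvv m (x : 'cV[R]_m) : dotv x x = sqn x.
Proof. by apply: eq_bigr => i _; rewrite expr2. Qed.

(** Lagrange's identity: the double sum of squares is twice the defect in the Cauchy-Schwarz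
    inequality. *)
Lemma dotv_sqr_le m (x y : 'cV[R]_m) : dotv x y ^+ 2 <= sqn x * sqn y.
Proof.
suff : 0 <= \sum_i \sum_j (x i 0 * y j 0 - x j 0 * y i 0) ^+ 2.
  have -> : \sum_i \sum_j (x i 0 * y j 0 - x j 0 * y i 0) ^+ 2 =
      \sum_i \sum_j (x i 0 ^+ 2 * y j 0 ^+ 2 + y i 0 ^+ 2 * x j 0 ^+ 2
        + -2 * ((x i 0 * y i 0) * (x j 0 * y j 0))).
    by apply: eq_bigr => i _; apply: eq_bigr => j _; ring.
  under eq_bigr do rewrite !big_split /= -!mulr_sumr -/(sqn x) -/(sqn y) -/(dotv x y).
  rewrite !big_split /= -!mulr_suml -/(sqn x) -/(sqn y) -mulr_sumr -mulr_suml.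
  rewrite -/(dotv x y); nra.
by do 2 (apply: sumr_ge0 => ? _); exact: sqr_ge0.
Qed.

Lemma sqn_mulmx_le m p (A : 'M[R]_(m, p)) (x : 'cV[R]_p) :
  sqn (A *m x) <= fro2 A * sqn x.
Proof.
rewrite /fro2 mulr_suml; apply: ler_sum => i _.
have -> : (A *m x) i 0 = dotv (row i A)^T x.
  by rewrite mxE; apply: eq_bigr => j _; rewrite !mxE.
apply: le_trans (dotv_sqr_le _ _) _; rewrite le_eqVlt; apply/orP; left; apply/eqP.
by congr (_ * _); apply: eq_bigr => j _; rewrite !mxE.
Qed.

Lemma qformD m (A B : 'M[R]_m) x : qform (A + B) x = qform A x + qform B x.
Proof. by rewrite /qform mulmxDr mulmxDl mxE. Qed.

Lemma qformZ m (a : R) (A : 'M[R]_m) x : qform (a *: A) x = a * qform A x.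
Proof. by rewrite /qform -scalemxAr -scalemxAl mxE. Qed.

Lemma qform_dotv m (A : 'M[R]_m) x : qform A x = dotv x (A *m x).
Proof. by rewrite /qform -mulmxA dotvE. Qed.

Lemma qform_scalar m (a : R) x : qform (a%:M : 'M[R]_m) x = a * sqn x.
Proof. by rewrite qform_dotv mul_scalar_mx dotvZr dotvv. Qed.

Lemma qform_tmul m p (A B : 'M[R]_(m, p)) x :
  qform (A^T *m B) x = dotv (A *m x) (B *m x).
Proof. by rewrite -dotvE /qform trmx_mul !mulmxA. Qed.

Lemma dotv_col m p (a c : 'cV[R]_m) (b d : 'cV[R]_p) :
  dotv (col_mx a b) (col_mx c d) = dotv a c + dotv b d.
Proof.
rewrite /dotv big_split_ord /=; congr (_ + _); apply: eq_bigr => i _.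
  by rewrite !col_mxEu.
by rewrite !col_mxEd.
Qed.

Lemma sqn_col m p (a : 'cV[R]_m) (b : 'cV[R]_p) : sqn (col_mx a b) = sqn a + sqn b.
Proof. by rewrite -!dotvv dotv_col. Qed.

Lemma qform_block m p (T : 'M[R]_m) (S : 'M[R]_(m, p)) (S' : 'M[R]_(p, m))
    (P : 'M[R]_p) x e :
  qform (block_mx T S S' P) (col_mx x e) =
  qform T x + dotv x (S *m e) + (dotv e (S' *m x) + qform P e).
Proof.
rewrite !qform_dotv mul_block_col dotv_col; congr (_ + _).
  by rewrite /dotv -big_split; apply: eq_bigr => i _; rewrite /= mxE mulrDr.
by rewrite /dotv -big_split; apply: eq_bigr => i _; rewrite /= mxE mulrDr.
Qed.

Lemma qform_block0 m p (T : 'M[R]_m) (S : 'M[R]_(m, p)) (S' : 'M[R]_(p, m))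
    (P : 'M[R]_p) e :
  qform (block_mx T S S' P) (col_mx 0 e) = qform P e.
Proof.
rewrite qform_block qform_dotv mulmx0 (_ : S' *m 0 = 0) ?mulmx0 //.
have d0 q (y : 'cV[R]_q) : dotv 0 y = 0.
  by rewrite /dotv big1 // => i _; rewrite mxE mul0r.
have d0' q (y : 'cV[R]_q) : dotv y 0 = 0.
  by rewrite /dotv big1 // => i _; rewrite mxE mulr0.
by rewrite !d0 d0' !add0r.
Qed.

Lemma dotv_tr m p (S : 'M[R]_(m, p)) x e : dotv e (S^T *m x) = dotv x (S *m e).
Proof.
rewrite -dotvE mulmxA -trmx_mul dotvE.
by apply: eq_bigr => i _; rewrite mulrC.
Qed.

(** After removing the identity, the cross term satisfies [u^2 <= a b] with [a = w |x|^2] and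
    [b = al |e|^2], so [a + b + 2 u >= 0] by the arithmetic-geometric inequality. *)
Lemma mxge_block m p (w al : R) (S : 'M[R]_(m, p)) (P : 'M[R]_p) :
  0 <= w -> 0 <= al -> fro2 S <= al * w -> mxge P (1 + al)%:M ->
  mxge (block_mx (1 + w)%:M S S^T P) 1%:M.
Proof.
move=> w0 al0 Sw Pge z; rewrite -(vsubmxK z); set x := usubmx z; set e := dsubmx z.
rewrite qform_scalar mul1r sqn_col qform_block dotv_tr qform_scalar.
have := Pge e; rewrite qform_scalar.
set q := qform P e; set u := dotv x (S *m e).
have : u ^+ 2 <= (w * sqn x) * (al * sqn e).
  apply: le_trans (dotv_sqr_le _ _) _.
  have h := le_trans (sqn_mulmx_le S e) (ler_wpM2r (sqn_ge0 e) Sw).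
  have := ler_wpM2l (sqn_ge0 x) h; nra.
have : 0 <= w * sqn x by rewrite mulr_ge0 // sqn_ge0.
have : 0 <= al * sqn e by rewrite mulr_ge0 // sqn_ge0.
set a := w * sqn x; set b := al * sqn e => b0 a0 uab qge.
suff : 0 <= a + b + 2 * u by rewrite /a /b in qge *; lra.
rewrite leNgt; apply/negP => neg; have := sqr_ge0 (a - b); nra.
Qed.

Lemma enorm_sqr m (x : 'cV[R]_m) : enorm x ^+ 2 = sqn x.
Proof. by rewrite /enorm sqr_sqrtr // sqn_ge0. Qed.

Lemma enorm_ge0 m (x : 'cV[R]_m) : 0 <= enorm x.
Proof. exact: sqrtr_ge0. Qed.

Lemma enorm_le m p (x : 'cV[R]_m) (y : 'cV[R]_p) (c : R) : 0 <= c ->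
  sqn x <= c ^+ 2 * sqn y -> enorm x <= c * enorm y.
Proof.
move=> c0 xy; rewrite -(@ler_pXn2r _ 2) ?nnegrE ?mulr_ge0 ?enorm_ge0 //.
by rewrite exprMn !enorm_sqr.
Qed.

(** With [p > 0] there are unit vectors, so the supremum is over a nonempty set; the Frobenius norm
    bounds it from above. Squares avoid the square root later on. *)
Lemma opnorm_le m p (A : 'M[R]_(m, p)) (L : R) : (0 < p)%N -> 0 <= L ->
  opnorm A <= L <-> forall x, sqn (A *m x) <= L ^+ 2 * sqn x.
Proof.
move=> p0 L0; split=> [AL x|AL].
  have hub : has_ubound [set enorm (A *m x) | x in [set x : 'cV[R]_p | enorm x = 1]].
    exists (Num.sqrt (fro2 A)) => _ [z /= z1 <-].
    rewrite -[leRHS]mulr1 -z1; apply: enorm_le; first exact: sqrtr_ge0.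
    by rewrite sqr_sqrtr ?fro2_ge0 // sqn_mulmx_le.
  have [x0|x0] := eqVneq (sqn x) 0.
    rewrite x0 mulr0; apply: le_trans (sqn_mulmx_le _ _) _.
    by rewrite x0 mulr0.
  have xe : enorm x != 0 by apply: contra_neq x0 => x0; rewrite -enorm_sqr x0 expr0n.
  have : enorm (A *m ((enorm x)^-1 *: x)) <= L.
    apply: le_trans AL; apply: ub_le_sup => //; eexists; last by [].
    apply/eqP; rewrite /= -(@eqrXn2 _ 2) ?enorm_ge0 //.
    by rewrite enorm_sqr sqnZ -enorm_sqr exprVn mulVf ?expr1n // expf_neq0.
  rewrite -(@ler_pXn2r _ 2) ?nnegrE ?enorm_ge0 // -scalemxAr enorm_sqr sqnZ.
  rewrite exprVn ler_pdivrMl ?exprn_gt0 ?lt_neqAle ?enorm_ge0 1?eq_sym ?xe //.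
  by rewrite enorm_sqr mulrC.
apply: sup_le_ub.
  exists (enorm (A *m delta_mx (Ordinal p0) 0)); exists (delta_mx (Ordinal p0) 0) => //.
  rewrite /= /enorm (bigD1 (Ordinal p0)) //= big1 ?addr0.
    by rewrite mxE !eqxx expr1n sqrtr1.
  by move=> i i0; rewrite mxE (negbTE i0) expr0n.
by move=> _ [z /= z1 <-]; rewrite -[L]mulr1 -z1; exact: enorm_le.
Qed.

End QuadraticForms.

(** * The exponent that makes the certificate strict *)

Section TimeGain.
Context {R : realType} (t1 E : R).

(** With [x = int d + E > 0] this is [x / (1 + x)], strictly between 0 and both [x] and 1. *)
Definition gap (d : R -> R) (t : R) : R := 1 - (1 + (int_from t1 d t + E))^-1.

(** With [s = t - t1] this is [s / (1 + s)]: it starts at 0, stays below 1, and its derivative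
    [(1 + s)^-2] has total integral at most 1. *)
Definition clock (t : R) : R := 1 - (1 + (t - t1))^-1.

Definition boost (d : R -> R) (t : R) : R := clock t * gap d t.

Definition boost' (d : R -> R) (t : R) : R :=
  (1 + (t - t1)) ^- 2 * gap d t + clock t * ((1 + (int_from t1 d t + E)) ^- 2 * d t).

Lemma clock_ge0 t : t1 <= t -> 0 <= clock t.
Proof.
by move=> t1t; rewrite /clock subr_ge0 invf_le1; lra.
Qed.

Lemma clock_lt1 t : t1 <= t -> clock t < 1.
Proof. by move=> t1t; rewrite /clock ltrBlDr ltrDl invr_gt0; lra. Qed.

Lemma clockE t : t1 <= t -> clock t = (t - t1) / (1 + (t - t1)).
Proof. by move=> t1t; rewrite /clock; field; lra. Qed.

Lemma C1_ray_shift : C1_from t1 (fun t => 1 + (t - t1)).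
Proof.
apply: C1_fromD; first exact: C1_from_cst.
by apply: C1_fromD; [exact: C1_from_id|exact: C1_from_cst].
Qed.

Lemma C1_clock : C1_from t1 clock.
Proof.
apply: C1_fromD; first exact: C1_from_cst.
apply: C1_fromN; apply: C1_fromV; last exact: C1_ray_shift.
by move=> t t1t; lra.
Qed.

Lemma der_from_clock t : t1 <= t -> der_from t1 clock t ((1 + (t - t1)) ^- 2).
Proof.
move=> t1t; have -> : clock = (fun s => 1 + -1 * (1 + (s + - t1))^-1).
  by apply/funext => s; rewrite mulN1r.
have dden : der_from t1 (fun s => 1 + (s + - t1)) t (0 + (1 + 0)).
  apply: der_fromD => //; first exact: der_from_cst.
  by apply: der_fromD => //; [exact: der_from_id|exact: der_from_cst].
have ne0 : 1 + (t + - t1) != 0 by lra.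
have := der_fromD t1t (der_from_cst (1 : R) t1t) (der_fromM t1t (der_from_cst (-1 : R) t1t) (der_fromV t1t ne0 dden)).
by rewrite mul0r !add0r addr0 mulr1 mulN1r opprK.
Qed.

Variable d : R -> R.
Hypotheses (cd : C0_from t1 d) (gd : gain_bounds t1 E d).

Let x_gt0 t : t1 <= t -> 0 < int_from t1 d t + E.
Proof. by move=> /gd.1; lra. Qed.

Lemma gap_gt0 t : t1 <= t -> 0 < gap d t.
Proof.
move=> /x_gt0 x0; rewrite /gap subr_gt0 invf_lt1; lra.
Qed.

Lemma gap_lt t : t1 <= t -> gap d t < int_from t1 d t + E.
Proof.
move=> /x_gt0; rewrite /gap; set x := int_from t1 d t + E => x0.
have -> : 1 - (1 + x)^-1 = x / (1 + x) by field; lra.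
rewrite ltr_pdivrMr; last lra.
by nra.
Qed.

Lemma gap_lt1 t : t1 <= t -> gap d t < 1.
Proof.
by move=> /x_gt0 x0; rewrite /gap ltrBlDr ltrDl invr_gt0; lra.
Qed.

Lemma der_from_gap t : t1 <= t ->
  der_from t1 (gap d) t ((1 + (int_from t1 d t + E)) ^- 2 * d t).
Proof.
move=> t1t.
have -> : gap d = (fun s => 1 + -1 * (1 + (int_from t1 d s + E))^-1).
  by apply/funext => s; rewrite mulN1r.
have dden : der_from t1 (fun s => 1 + (int_from t1 d s + E)) t (0 + (d t + 0)).
  apply: der_fromD => //; first exact: der_from_cst.
  by apply: der_fromD => //; [exact: int_from_wder|exact: der_from_cst].
have ne0 : 1 + (int_from t1 d t + E) != 0 by have := x_gt0 t1t; lra.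
have := der_fromD t1t (der_from_cst (1 : R) t1t) (der_fromM t1t (der_from_cst (-1 : R) t1t) (der_fromV t1t ne0 dden)).
by rewrite mul0r !add0r addr0 mulN1r mulNr opprK.
Qed.

Let C0_x : C0_from t1 (fun t => 1 + (int_from t1 d t + E)).
Proof.
apply: C0_fromD; first exact: C0_from_cst.
apply: C0_fromD; last exact: C0_from_cst.
by apply: der_from_C0 => t t1t; exact: int_from_wder.
Qed.

Let C0_gap' : C0_from t1 (fun t => (1 + (int_from t1 d t + E)) ^- 2 * d t).
Proof.
apply: C0_fromM => //; apply: C0_fromV; last exact: C0_fromM.
by move=> t /x_gt0 x0; rewrite expf_neq0; lra.
Qed.

Lemma C1_gap : C1_from t1 (gap d).
Proof.
apply/C1_fromP; exists (fun t => (1 + (int_from t1 d t + E)) ^- 2 * d t) => //.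
exact: der_from_gap.
Qed.

Lemma der_from_boost t : t1 <= t -> der_from t1 (boost d) t (boost' d t).
Proof. by move=> t1t; apply: der_fromM => //; [exact: der_from_clock|exact: der_from_gap]. Qed.

Lemma C0_boost' : C0_from t1 (boost' d).
Proof.
apply: C0_fromD; apply: C0_fromM => //.
- apply: C0_fromV; first by move=> t t1t; rewrite expf_neq0; lra.
  by apply: C0_fromM; apply: C1_from_C0; exact: C1_ray_shift.
- by apply: C1_from_C0; exact: C1_gap.
- by apply: C1_from_C0; exact: C1_clock.
Qed.

Lemma boost_ge0 t : t1 <= t -> 0 <= boost d t.
Proof. by move=> t1t; rewrite mulr_ge0 // ?clock_ge0 // ltW // gap_gt0. Qed.

Lemma boost_le_gap t : t1 <= t -> boost d t <= gap d t.
Proof.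
move=> t1t; rewrite -[leRHS]mul1r ler_wpM2r //; first by rewrite ltW // gap_gt0.
by rewrite ltW // clock_lt1.
Qed.

Lemma boost_id : boost d t1 = 0.
Proof. by rewrite /boost /clock subrr addr0 invr1 subrr mul0r. Qed.

(** The integral loses exactly [boost d t]. Being below [int d + E], this loss keeps the lower bound
    [- E]; being below 1, it keeps the divergence. *)
Lemma gain_bounds_boost : gain_bounds t1 E (fun t => d t - boost' d t).
Proof.
have IE t : t1 <= t ->
    int_from t1 (fun t => d t - boost' d t) t = int_from t1 d t - boost d t.
  move=> t1t; rewrite int_fromD //; last by apply: C0_fromN; exact: C0_boost'.
  rewrite int_fromN //; last exact: C0_boost'.
  rewrite (int_from_primitive der_from_boost C0_boost') //.
  by rewrite boost_id subr0.
split=> [t t1t|].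
  by rewrite IE //; have := boost_le_gap t1t; have := gap_lt t1t; lra.
apply/cvgryPge => A; have /cvgryPge/(_ (A + 1)) := gd.2.
apply: filterS2 (nbhs_pinfty_ge (num_real t1)) => t t1t IA.
by rewrite IE //; have := boost_le_gap t1t; have := gap_lt1 t1t; lra.
Qed.

End TimeGain.

(** * Passing to a strictly larger certificate *)

Section StrictCertificate.
Context {R : realType}.

Lemma int_from_eq (t1 : R) (f g : R -> R) t :
  (forall s, t1 <= s <= t -> f s = g s) -> int_from t1 f t = int_from t1 g t.
Proof.
by move=> fg; apply: eq_Rintegral => s; rewrite inE /= in_itv /= => /fg.
Qed.

Lemma noncausal_eqs k (X : Type) (t0 t1 tau : R) (Y : set (R -> 'cV[R]_k))
    (F : (R -> 'cV[R]_k) -> R -> X) : noncausal t0 t1 tau Y F ->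
  forall y1 y2, Y y1 -> Y y2 -> forall t,
    (forall s, t0 <= s <= t + tau -> y1 s = y2 s) ->
    forall s, t1 <= s -> s <= t -> F y1 s = F y2 s.
Proof.
move=> cF y1 y2 Y1 Y2 t y12 s t1s st; apply: cF => // r /andP[t0r rs].
by apply: y12; rewrite t0r /= (le_trans rs) // lerD2r.
Qed.

(* The growing factor [expR (2 * boost)] makes [P > 1] after [t1] without
   moving [P t1], at the price of the bounded quantity [boost], which stays
   below the available gain margin [int d + E]. *)
Lemma certificate_strict n k l m p
    (B : R -> 'cV[R]_k -> 'M[R]_(m, p))
    (D : R -> 'cV[R]_l -> 'cV[R]_k -> 'M[R]_p)
    (yf : R -> 'cV[R]_n -> R -> 'cV[R]_k) (U W : set 'cV[R]_n)
    (L E t0 : R) (Q : R -> set 'cV[R]_l) (t1 tau0 : R) P0 d0 :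
  kernel_certificate B D yf U W L E t0 Q t1 tau0 P0 d0 ->
  exists P d (psi : (R -> 'cV[R]_k) -> R -> R),
  [/\ kernel_certificate B D yf U W L E t0 Q t1 tau0 P d,
      noncausal t0 t1 tau0 (OmegaC0 yf U t0) psi &
      forall y, OmegaC0 yf U t0 y ->
      [/\ C1_from t1 (psi y), forall t, t1 <= t -> 0 < psi y t &
          forall t, t1 <= t -> mxge (P y t)
            (1 + 2 * ((t - t1) / (1 + (t - t1)) * psi y t))%:M]].
Proof.
move=> [cP cd H].
pose c (y : R -> 'cV[R]_k) t := expR (2 * boost t1 E (d0 y) t).
exists (fun y t => c y t *: P0 y t), (fun y t => d0 y t - boost' t1 E (d0 y) t),
  (fun y => gap t1 E (d0 y)).
have cI : noncausal t0 t1 tau0 (OmegaC0 yf U t0) (fun y => int_from t1 (d0 y)).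
  move=> y1 y2 Y1 Y2 t t1t y12; apply: int_from_eq => s /andP[t1s st].
  exact: (noncausal_eqs cd Y1 Y2 y12).
have cgap : noncausal t0 t1 tau0 (OmegaC0 yf U t0) (fun y => gap t1 E (d0 y)).
  by move=> y1 y2 Y1 Y2 t t1t y12; rewrite /gap (cI _ _ Y1 Y2 t t1t y12).
have cge1 y : OmegaC0 yf U t0 y -> forall t, t1 <= t -> 1 <= c y t.
  move=> Yy t t1t; have [_ cdy _ gd _] := H y Yy.
  rewrite -expR0 ler_expR mulr_ge0 //; exact: (boost_ge0 gd).
have P0ge1 y : OmegaC0 yf U t0 y -> forall t, t1 <= t -> forall x,
    sqn x <= qform (P0 y t) x.
  move=> Yy t t1t x; have [_ _ [Pge _] _ _] := H y Yy.
  by have := Pge t t1t x; rewrite qform_scalar mul1r.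
split=> //; last first.
  move=> y Yy; have [_ cdy _ gd _] := H y Yy; split=> [|t t1t|t t1t x].
  - exact: C1_gap.
  - exact: gap_gt0.
  - rewrite qformZ qform_scalar -clockE // -/(boost t1 E (d0 y) t).
    (* Combines [exp x >= 1 + x] at [x = 2 boost] with [P0 >= 1]. *)
    apply: ler_pM => //; rewrite ?sqn_ge0 ?P0ge1 //.
      by rewrite addr_ge0 // mulr_ge0 // (boost_ge0 gd).
    exact: expR_ge1Dx.
split.
- move=> y1 y2 Y1 Y2 t t1t y12; rewrite /c /boost.
  by rewrite (cP _ _ Y1 Y2 t t1t y12) (cgap _ _ Y1 Y2 t t1t y12).
- move=> y1 y2 Y1 Y2 t t1t y12; rewrite /boost'.
  by rewrite (cd _ _ Y1 Y2 t t1t y12) (cgap _ _ Y1 Y2 t t1t y12) (cI _ _ Y1 Y2 t t1t y12).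
move=> y Yy; have [[C1P symP] cdy [Pge PL] gd ineq] := H y Yy.
have dc t : t1 <= t -> der_from t1 (c y) t (c y t * (2 * boost' t1 E (d0 y) t)).
  move=> t1t; apply: der_from_comp => //.
  rewrite -[2 * boost' _ _ _ _]add0r -(mul0r (boost t1 E (d0 y) t)).
  by apply: der_fromM => //; [exact: der_from_cst|exact: der_from_boost].
have C0b := C0_boost' cdy gd.
have C1c : C1_from t1 (c y).
  apply/C1_fromP; exists (fun t => c y t * (2 * boost' t1 E (d0 y) t)) => //.
  apply: C0_fromM; first exact: der_from_C0 dc.
  by apply: C0_fromM => //; exact: C0_from_cst.
split.
- split; last by move=> t t1t; rewrite linearZ /= symP.
  apply/C1_mxP => i j; under eq_fun do rewrite mxE.
  by apply: (C1_fromM C1c); move/C1_mxP : C1P; exact.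
- by apply: C0_fromD => //; exact: C0_fromN.
- split=> [t t1t x|].
    rewrite qformZ qform_scalar mul1r; apply: le_trans (P0ge1 y Yy t t1t x) _.
    rewrite ler_peMl ?cge1 // (le_trans _ (P0ge1 y Yy t t1t x)) //; exact: sqn_ge0.
  by rewrite /c boost_id // mulr0 expR0 scale1r.
- exact: gain_bounds_boost.
move=> Yw t e q t1t Be Qtq; have := ineq Yw t e q t1t Be Qtq.
have /der_from_derive_within dP := C1P.1 t t1t.
(* Half the derivative of [exp (2 b)] is [b'] times this factor, so the new term is [b' e'Pe] and
   moves into the gain [d - b']. *)
have /der_fromE[//|_ ->] : der_from t1 (fun s => c y s *: P0 y s) t
    ((c y t * (2 * boost' t1 E (d0 y) t)) *: P0 y t
      + c y t *: derive_within `[t1, +oo[ (P0 y) t).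
  apply/der_from_mxP => // i j; under eq_fun do rewrite mxE.
  rewrite !mxE; apply: der_fromM => //; first exact: dc.
  by move/der_from_mxP : dP; exact.
rewrite -scalemxAl qformD !qformZ => h.
have c0 : 0 < c y t by exact: expR_gt0.
have := ler_wpM2l (ltW c0) h; lra.
Qed.

End StrictCertificate.

(** * Limits of products and quadratic forms *)

Section MatrixCvg.
Context {R : realType} {T : Type} (F : set_system T) {FF : Filter F}.

Lemma cvg_mulmx m p r (A : T -> 'M[R]_(m, p)) (B : T -> 'M[R]_(p, r))
    (a : 'M[R]_(m, p)) (b : 'M[R]_(p, r)) :
  A @ F --> a -> B @ F --> b -> (fun x => A x *m B x) @ F --> a *m b.
Proof.
move=> /cvg_mxP Aa /cvg_mxP Bb; apply/cvg_mxP => i j; rewrite mxE.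
under eq_fun do rewrite mxE.
apply: cvg_big => [|l _]; first exact: add_continuous.
exact: cvgM.
Qed.

Lemma cvg_trmx m p (A : T -> 'M[R]_(m, p)) (a : 'M[R]_(m, p)) :
  A @ F --> a -> (fun x => (A x)^T) @ F --> a^T.
Proof.
move=> /cvg_mxP Aa; apply/cvg_mxP => i j; rewrite mxE.
by under eq_fun do rewrite mxE; exact: Aa.
Qed.

Lemma cvg_qform m (A : T -> 'M[R]_m) (x : T -> 'cV[R]_m)
    (a : 'M[R]_m) (x0 : 'cV[R]_m) :
  A @ F --> a -> x @ F --> x0 -> (fun s => qform (A s) (x s)) @ F --> qform a x0.
Proof.
move=> Aa xx0; have /cvg_mxP h := cvg_mulmx (cvg_mulmx (cvg_trmx xx0) Aa) xx0.
exact: h.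
Qed.

Lemma cvg_sqn m (x : T -> 'cV[R]_m) (x0 : 'cV[R]_m) :
  x @ F --> x0 -> (fun s => sqn (x s)) @ F --> sqn x0.
Proof.
move=> /cvg_mxP xx0; apply: cvg_big => [|i _]; first exact: add_continuous.
rewrite expr2; under eq_fun do rewrite expr2.
by apply: cvgM; exact: xx0.
Qed.

End MatrixCvg.

(** * From decay on the kernel to an estimate for all vectors *)

Section CompactDomination.
Context {R : realType}.

Lemma C0_from_seq (V : normedModType R) (t1 : R) (f : R -> V) (u : nat -> R) t :
  C0_from t1 f -> (forall i, t1 <= u i) -> t1 <= t -> u @ \oo --> t ->
  f (u i) @[i --> \oo] --> f t.
Proof.
move=> /C0_fromP cf t1u t1t ut; apply: (cvg_comp u f _ (cf t t1t)) => A.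
rewrite /within /= => /ut; rewrite !nbhs_filterE /fmap /=.
by apply: filterS => i; apply; rewrite /= in_itv /= andbT.
Qed.

Lemma homo_ltn_leq (phi : nat -> nat) : {homo phi : i j / (i < j)%N} ->
  forall i, (i <= phi i)%N.
Proof.
move=> inc; elim=> // i ih; apply: leq_ltn_trans ih _; exact: inc.
Qed.

Lemma homo_ltn_cvg (phi : nat -> nat) : {homo phi : i j / (i < j)%N} ->
  phi @ \oo --> \oo.
Proof.
move=> inc A [N _ NA]; exists N => // i /= Ni; apply: NA => /=.
exact: leq_trans Ni (homo_ltn_leq inc i).
Qed.

(** A cluster point [x] lets each new index be chosen beyond the previous one with its term within
    [1 / (m + 1)] of [x]. *)
Lemma compact_subseq (V : normedModType R) (K : set V) (u : nat -> V) :
  compact K -> (forall i, K (u i)) ->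
  exists (phi : nat -> nat) (x : V),
    {homo phi : i j / (i < j)%N} /\ (u \o phi) @ \oo --> x.
Proof.
move=> cK Ku; have [x [Kx clx]] := cK (u @ \oo) _ (filterE _ Ku).
have next (i m : nat) : {j | (i < j)%N /\ ball x m.+1%:R^-1 (u j)}.
  apply/cid; have [||_ [[j ij <-] xj]] := clx [set u j | j in [set j | (i < j)%N]]
    (ball x m.+1%:R^-1).
  - by exists i.+1 => // j /= ij; exists j.
  - by apply: nbhsx_ballx; rewrite invr_gt0 ltr0n.
  by exists j.
pose phi := fix phi m := if m is m'.+1 then sval (next (phi m') m) else sval (next 0%N 0%N).
exists phi, x; split.
  apply: homo_ltn => [? ? ?|m]; first exact: ltn_trans.
  by rewrite /=; case: (next _ _) => j [].
have phi_ball m : ball x m.+1%:R^-1 (u (phi m)).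
  by case: m => [|m] /=; case: (next _ _) => j [].
apply/cvg_ballP => e e0; near=> m => /=; apply: le_ball (phi_ball m).
 near: m; exists (Num.bound e^-1) => // m /= em.
rewrite -[leRHS]invrK lef_pV2 ?posrE ?invr_gt0 ?ltr0n //.
apply: le_trans (ltW (archi_boundP _)) _; first by rewrite invr_ge0 ltW.
by rewrite ler_nat leqW.
Unshelve. all: by end_near. Qed.

(** A Finsler-type argument by contradiction. If every [N = i] fails, there are violating times,
    parameters and unit vectors; compactness of [[a, b]], CP and compactness of a box give a limit.
    There [B e = 0], as [i |B e_i|^2] stays bounded, yet the form is at least [eta > 0]. *)
Lemma compact_domination l m p (X : R -> 'cV[R]_l -> 'M[R]_p)
    (Bt : R -> 'M[R]_(m, p)) (eta : R -> R) (Q : R -> set 'cV[R]_l) (t0 t1 a b : R) :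
  CP t0 Q -> t0 <= t1 -> t1 <= a ->
  (forall (u : nat -> R) (q : nat -> 'cV[R]_l) t q', (forall i, t1 <= u i) ->
     t1 <= t -> u @ \oo --> t -> q @ \oo --> q' ->
     X (u i) (q i) @[i --> \oo] --> X t q') ->
  C0_from t1 Bt -> C0_from t1 eta -> (forall t, t1 <= t -> 0 < eta t) ->
  (forall t q e, t1 <= t -> Q t q -> Bt t *m e = 0 -> qform (X t q) e <= 0) ->
  exists2 N, 0 <= N & forall t q e, a <= t <= b -> Q t q ->
    qform (X t q) e <= eta t * sqn e + N * sqn (Bt t *m e).
Proof.
move=> hCP t01 t1a cX cB ceta eta0 ker; apply: contrapT => no.
(* Vectors are stored as rows to match [rV_compact]. A violating vector is nonzero, hence can be
   normalized since both sides are homogeneous of degree two. *)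
have wit (i : nat) : exists z : R * 'cV[R]_l * 'rV[R]_p,
    [/\ a <= z.1.1 <= b, Q z.1.1 z.1.2, sqn z.2^T = 1 &
     eta z.1.1 + i%:R * sqn (Bt z.1.1 *m z.2^T) < qform (X z.1.1 z.1.2) z.2^T].
  apply: contrapT => noi; apply: no; exists i%:R => // t q e tab Qq.
  rewrite leNgt; apply/negP => lt.
  have e0 : 0 < sqn e.
    rewrite lt_neqAle sqn_ge0 andbT; apply/eqP => e0; move: lt.
    have {}e0 : e = 0.
      apply/matrixP => r s; rewrite ord1 mxE; apply/eqP; rewrite -sqrf_eq0.
      move/esym/eqP : e0; rewrite psumr_eq0 => [/allP /(_ r)|? _]; last exact: sqr_ge0.
      by rewrite mem_index_enum; exact.
    by rewrite e0 /qform mulmx0 mulmx0 mxE -(scale0r (0 : 'cV[R]__)) sqnZ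
      -[X in _ + _ * sqn X](scale0r (0 : 'cV[R]__)) sqnZ expr0n !mul0r !mulr0 addr0 ltxx.
  apply: noi; exists (t, q, (enorm e)^-1 *: e^T) => /=.
  have en : enorm e ^+ 2 = sqn e by exact: enorm_sqr.
  have en0 : enorm e != 0 by apply: contraTneq e0 => E; rewrite -en E expr0n ltxx.
  have qZ A : qform A ((enorm e)^-1 *: e) = (sqn e)^-1 * qform A e.
    by rewrite !qform_dotv -scalemxAr dotvZl dotvZr mulrA -invfM -expr2 en.
  rewrite linearZ /= trmxK qZ -scalemxAr !sqnZ exprVn en mulVf ?gt_eqF //.
  split=> //; rewrite [ltRHS]mulrC ltr_pdivlMr //; move: lt.
  set s := sqn e in e0 *; set c := sqn (Bt t *m e).
  suff -> : (eta t + i%:R * (s^-1 * c)) * s = eta t * s + i%:R * c by [].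
  by field; rewrite gt_eqF.
have [z zP] := choice wit.
have t1u i : t1 <= (z i).1.1 by have [/andP[+ _] _ _ _] := zP i; exact: le_trans.
have [phi1 [t [inc1 ut]]] : exists (phi : nat -> nat) (t : R),
    {homo phi : i j / (i < j)%N} /\ (fun i => (z (phi i)).1.1) @ \oo --> t.
  apply: (compact_subseq (u := fun i => (z i).1.1) (@segment_compact _ a b)) => i.
  by rewrite /= in_itv /=; have [] := zP i.
have t1t : t1 <= t.
  by apply: (cvgr_to_ge ut); apply: nearW => i; exact: t1u.
have Qz i : Q (z (phi1 i)).1.1 (z (phi1 i)).1.2 by have [] := zP (phi1 i).
have [phi2 [q [inc2 Qq qcvg]]] :=
  hCP _ t (fun i => (z (phi1 i)).1.2) (fun i => le_trans t01 (t1u (phi1 i)))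
  (le_trans t01 t1t) ut Qz.
have [phi3 [v [inc3 vcvg]]] : exists (phi : nat -> nat) (v : 'rV[R]_p),
    {homo phi : i j / (i < j)%N} /\ (fun i => (z (phi1 (phi2 (phi i)))).2) @ \oo --> v.
  have cK : compact [set w : 'rV[R]_p | forall j, `[-1, 1]%classic (w ord0 j)].
    by apply: (@rV_compact R p (fun=> `[-1, 1]%classic)) => _; exact: segment_compact.
  apply: (compact_subseq (u := fun i => (z (phi1 (phi2 i))).2) cK) => i j.
  have [_ _ nrm _] := zP (phi1 (phi2 i)).
  rewrite /= in_itv /= -ler_norml -(@ler_pXn2r _ 2) ?nnegrE // expr1n -normrX.
  rewrite ger0_norm ?sqr_ge0 // -nrm /sqn (bigD1 j) //= mxE lerDl.
  by apply: sumr_ge0 => r _; exact: sqr_ge0.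
pose psi i := phi1 (phi2 (phi3 i)).
have inc : {homo psi : i j / (i < j)%N} by move=> i j ij; apply: inc1; apply: inc2; exact: inc3.
have u3 : (fun i => (z (psi i)).1.1) @ \oo --> t.
  apply: (cvg_comp (fun i => phi2 (phi3 i)) (fun i => (z (phi1 i)).1.1)) ut.
  by apply: homo_ltn_cvg => i j ij; apply: inc2; exact: inc3.
have q3 : (fun i => (z (psi i)).1.2) @ \oo --> q.
  exact: (cvg_comp phi3 (fun i => (z (phi1 (phi2 i))).1.2) (homo_ltn_cvg inc3) qcvg).
have e3 : (fun i => (z (psi i)).2^T) @ \oo --> v^T by exact: cvg_trmx.
have t1z i : t1 <= (z (psi i)).1.1 by exact: t1u.
have Bcvg : sqn (Bt (z (psi i)).1.1 *m (z (psi i)).2^T) @[i --> \oo] --> sqn (Bt t *m v^T).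
  apply: cvg_sqn; apply: cvg_mulmx => //.
  exact: C0_from_seq cB t1z t1t u3.
have ecvg : eta (z (psi i)).1.1 @[i --> \oo] --> eta t.
  exact: C0_from_seq ceta t1z t1t u3.
have Xcvg : qform (X (z (psi i)).1.1 (z (psi i)).1.2) (z (psi i)).2^T @[i --> \oo]
    --> qform (X t q) v^T.
  by apply: cvg_qform => //; apply: cX => // i; exact: t1u.
(* Were the limit [b] of [|B e_i|^2] positive, eventually [i |B e_i|^2 > i b / 2] would exceed the
   bounded forms. *)
have Be0 : sqn (Bt t *m v^T) = 0.
  apply/eqP; rewrite eq_le sqn_ge0 andbT leNgt; apply/negP => be0.
  have be2 : sqn (Bt t *m v^T) / 2 < sqn (Bt t *m v^T) by lra.
  have hB : \forall i \near \oo,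
      sqn (Bt t *m v^T) / 2 < sqn (Bt (z (psi i)).1.1 *m (z (psi i)).2^T).
    exact: cvgr_gt Bcvg _ be2.
  have hX : \forall i \near \oo,
      qform (X (z (psi i)).1.1 (z (psi i)).1.2) (z (psi i)).2^T < qform (X t q) v^T + 1.
    by apply: cvgr_lt Xcvg _ _; rewrite ltrDl.
  have hN : \forall i \near \oo, (qform (X t q) v^T + 1) / (sqn (Bt t *m v^T) / 2) <= i%:R.
    exact: nbhs_infty_ger.
  have [i [[Bi Xi] Ni]] := filter_ex (filterI (filterI hB hX) hN).
  have [/andP[ai _] _ _ lt] := zP (psi i).
  have : i%:R <= (psi i)%:R :> R by rewrite ler_nat; exact: homo_ltn_leq.
  have := eta0 _ (t1u (psi i)).
  rewrite ler_pdivrMr in Ni; last lra.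
  have : (0 : R) <= i%:R by [].
  nra.
have := ker t q v^T t1t Qq.
have -> : Bt t *m v^T = 0.
  apply/matrixP => r s; rewrite ord1 [RHS]mxE; apply/eqP; rewrite -sqrf_eq0.
  move/eqP : Be0; rewrite psumr_eq0 => [/allP /(_ r)|? _]; last exact: sqr_ge0.
  by rewrite mem_index_enum; exact.
move=> /(_ erefl); apply/negP; rewrite -ltNge; apply: lt_le_trans (eta0 t t1t) _.
apply: ler_cvg_to ecvg Xcvg _; apply: nearW => i.
have [_ _ _ lt] := zP (psi i); apply: le_trans (ltW lt).
by rewrite lerDl mulr_ge0 // sqn_ge0.
Qed.

End CompactDomination.

(** * Causal majorants of pointwise requirements *)

Section CausalMajorant.
Context {R : realType}.

Lemma noncausal_weaken k (X : Type) (t0 t1 tau tau' : R) (Y : set (R -> 'cV[R]_k))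
    (F : (R -> 'cV[R]_k) -> R -> X) : tau <= tau' ->
  noncausal t0 t1 tau Y F -> noncausal t0 t1 tau' Y F.
Proof.
move=> le cF y1 y2 Y1 Y2 t t1t y12; apply: cF => // s /andP[t0s st].
by apply: y12; rewrite t0s (le_trans st) // lerD2l.
Qed.

Lemma ray_cell (t1 h t : R) : 0 < h -> t1 <= t ->
  exists j : nat, t1 + j%:R * h <= t <= t1 + j%:R * h + h.
Proof.
move=> h0 t1t; have x0 : 0 <= (t - t1) / h by rewrite divr_ge0 ?subr_ge0 // ltW.
have /andP[lb ub] := truncn_itv x0.
exists (Num.truncn ((t - t1) / h)); move: lb ub; set j := Num.truncn _.
rewrite ler_pdivlMr // ltr_pdivrMr //.
by rewrite -natr1 mulrDl mul1r => lb ub; apply/andP; split; lra.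
Qed.

(* Where no finite bound exists on a cell the requirement is dropped, so that
   the construction applies to every output while remaining causal. *)
Lemma causal_pointwise_majorant k (Y : set (R -> 'cV[R]_k)) (t0 t1 sg h : R)
    (G : (R -> 'cV[R]_k) -> R -> R -> Prop) : 0 < h ->
  (forall y t v v', G y t v -> v <= v' -> G y t v') ->
  noncausal t0 t1 sg Y G ->
  exists V : (R -> 'cV[R]_k) -> R -> R,
    noncausal t0 t1 (sg + h + h) Y V /\
    forall y, Y y -> C1_from t1 (V y) /\
      ((forall a b, t1 <= a -> exists2 v, 0 <= v & forall t, a <= t <= b -> G y t v) ->
       forall t, t1 <= t -> G y t (V y t)).
Proof.
move=> h0 upG cG.
pose good y j v := forall t, t1 + j%:R * h <= t <= t1 + j%:R * h + h -> G y t v.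
pose G' y j v := (exists2 v', 0 <= v' & good y j v') -> good y j v.
(* A requirement on a whole cell is determined only [h + sg] after its left end; the ramps add the
   second [h]. *)
have goodE y1 y2 : Y y1 -> Y y2 -> forall j,
    (forall s, t0 <= s <= t1 + j%:R * h + (sg + h) -> y1 s = y2 s) ->
    forall v, good y1 j v -> good y2 j v.
  move=> Y1 Y2 j y12 v gd t /andP[jt tj].
  have t1t : t1 <= t by apply: le_trans jt; rewrite lerDl mulr_ge0 // ltW.
  rewrite -(cG _ _ Y1 Y2 t t1t); first by apply: gd; rewrite jt.
  by move=> s /andP[t0s st]; apply: y12; rewrite t0s /=; lra.
have [||V [cV HV]] := @causal_majorant R t1 h h0 k Y t0 (sg + h) G'.
- move=> y Yy j; have [[v v0 gv]|no] := pselect (exists2 v, 0 <= v & good y j v).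
    by exists v.
  by exists 0 => // /no.
- move=> y1 y2 Y1 Y2 j y12 v Gv [v' v'0 gv']; apply: (goodE y1 y2) => //.
  apply: Gv; exists v' => //; apply: (goodE y2 y1) => // s /y12.
  by move=> ->.
exists V; split=> // y Yy; have [C1V VG] := HV y Yy; split=> // ex t t1t.
have [j jt] := ray_cell h0 t1t; have [v [v0 Gv vV]] := VG j.
apply: upG (vV t _); last by case/andP: jt.
apply: Gv jt; apply: ex; by rewrite lerDl mulr_ge0 // ltW.
Qed.

(** A derivative at [t] sees values slightly after [t], so causality of [derive_within] costs a
    positive, arbitrarily small, anticipation. *)
Lemma derive_within_local (V : normedModType R) (t1 T : R) (f g : R -> V) t :
  t1 <= t -> t < T -> derivable_within `[t1, +oo[ f t ->
  (forall s, t1 <= s -> s < T -> f s = g s) ->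
  derive_within `[t1, +oo[ f t = derive_within `[t1, +oo[ g t.
Proof.
move=> t1t tT df fg.
by have [_ ->] := der_fromE t1t (der_from_near_ext t1t tT fg (der_from_derive_within df)).
Qed.

End CausalMajorant.

(** * Forward averages over variable windows *)

Section Averaging.
Context {R : realType} (t1 : R).

(** The mean of [g] over the window from [t] to [t + 1 / V t]. A larger [V] means a shorter window,
    so a suitable [V] comes from a majorant. *)
Definition avg (g V : R -> R) (t : R) : R :=
  (int_from t1 g (t + (V t)^-1) - int_from t1 g t) * V t.

Variables (g V : R -> R).
Hypotheses (cg : C0_from t1 g) (cV : C1_from t1 V) (V0 : forall t, t1 <= t -> 0 < V t).

Lemma C1_int_from : C1_from t1 (int_from t1 g).
Proof.
by apply/C1_fromP; exists g => // t t1t; exact: int_from_wder.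
Qed.

(** Since [t + rho t > t1], the outer derivative is two-sided even at [t = t1]. *)
Lemma C1_from_advance (F rho : R -> R) : C1_from t1 F -> C1_from t1 rho ->
  (forall t, t1 <= t -> 0 < rho t) -> C1_from t1 (fun t => F (t + rho t)).
Proof.
move=> /C1_fromP[f Ff cf] crho rho0; have /C1_fromP[r rhor cr] := crho.
have adv t : t1 <= t -> t1 < t + rho t by move=> t1t; have := rho0 t t1t; lra.
apply/C1_fromP; exists (fun t => f (t + rho t) * (1 + r t)).
  move=> t t1t; apply: (@der_from_comp _ _ F (fun s => s + rho s)) => //.
    apply: (@der_from_interior _ t1); first exact: adv.
    by apply: Ff; rewrite ltW // adv.
  by apply: der_fromD => //; [exact: der_from_id|exact: rhor].
apply: C0_fromM; last by apply: C0_fromD => //; exact: C0_from_cst.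
apply/C0_fromP => t t1t; have := @C0_clamp _ _ _ f cf (t + rho t).
have cadv : C0_from t1 (fun s => s + rho s).
  exact: (C1_from_C0 (C1_fromD (C1_from_id t1) crho)).
have /C0_fromP/(_ t t1t) ca := cadv.
move=> /(cvg_comp _ _ ca); rewrite max_r ?(ltW (adv _ _)) //; apply: cvg_trans.
apply: near_eq_cvg; rewrite near_withinE; apply: nearW => s.
by rewrite /= in_itv /= andbT => t1s; rewrite max_r // ltW // adv.
Qed.

Lemma C1_avg : C1_from t1 (avg g V).
Proof.
have Vn0 t : t1 <= t -> V t != 0 by move=> /V0 h; rewrite gt_eqF.
apply: (C1_fromM _ cV); apply: (C1_fromD _ (C1_fromN C1_int_from)).
apply: (C1_from_advance C1_int_from (rho := fun t => (V t)^-1)).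
  exact: C1_fromV.
by move=> t t1t; rewrite invr_gt0 V0.
Qed.

Lemma avg_mean t : t1 <= t ->
  exists u, [/\ 0 <= u, u * V t <= 1 & avg g V t = g (t + u)].
Proof.
move=> t1t; have Vt := V0 t1t; have Vi : 0 < (V t)^-1 by rewrite invr_gt0.
have [|c /andP[tc ct] E] := der_from_mvt (fun s t1s => int_from_wder cg t1s) t1t
  (_ : t <= t + (V t)^-1); first by rewrite lerDl ltW.
exists (c - t); rewrite subr_ge0 tc /avg E addrAC subrr add0r mulfVK ?gt_eqF //.
rewrite addrCA subrr addr0; split=> //.
by rewrite -(mulVf (lt0r_neq0 Vt)) ler_pM2r //; lra.
Qed.

End Averaging.

(** * Uniform oscillation bounds and summation over cells *)

Section Oscillation.
Context {R : realType}.

Lemma fro2_entry m p (A : 'M[R]_(m, p)) i j : A i j ^+ 2 <= fro2 A.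
Proof.
rewrite /fro2 (bigD1 i) //= (bigD1 j) //= -addrA lerDl addr_ge0 //.
  by apply: sumr_ge0 => ? _; exact: sqr_ge0.
by do 2 (apply: sumr_ge0 => ? _); exact: sqr_ge0.
Qed.

Lemma cvg_fro2 {T : Type} (F : set_system T) {FF : Filter F} m p (A : T -> 'M[R]_(m, p))
    (a : 'M[R]_(m, p)) : A @ F --> a -> (fun x => fro2 (A x)) @ F --> fro2 a.
Proof.
move=> /cvg_mxP Aa; apply: cvg_big => [|i _]; first exact: add_continuous.
apply: cvg_big => [|j _]; first exact: add_continuous.
by rewrite expr2; under eq_fun do rewrite expr2; apply: cvgM; exact: Aa.
Qed.

Lemma C0_fro2 (t1 : R) m p (A : R -> 'M[R]_(m, p)) :
  C0_from t1 A -> C0_from t1 (fun t => fro2 (A t)).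
Proof.
by move=> /C0_fromP cA; apply/C0_fromP => t t1t; apply: cvg_fro2; exact: cA.
Qed.

(** Uniform continuity with a variable tolerance. If each [v = i + 1] fails, the shifts are at most
    [1 / (i + 1)], and a limit of the violating times gives [kap t <= 0]. *)
Lemma oscillation_bound m p (t1 a b : R) (g : R -> 'M[R]_(m, p)) (kap : R -> R) :
  C0_from t1 g -> C0_from t1 kap -> (forall t, t1 <= t -> 0 < kap t) -> t1 <= a ->
  exists2 v, 0 <= v & forall t, a <= t <= b -> forall u, 0 <= u -> u * v <= 1 ->
    fro2 (g (t + u) - g t) <= kap t.
Proof.
move=> cg ckap kap0 t1a; apply: contrapT => no.
have wit (i : nat) : exists z : R * R, [/\ a <= z.1 <= b, 0 <= z.2, z.2 * i.+1%:R <= 1 &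
    kap z.1 < fro2 (g (z.1 + z.2) - g z.1)].
  apply: contrapT => noi; apply: no; exists i.+1%:R => // t tab u u0 ui.
  by rewrite leNgt; apply/negP => lt; apply: noi; exists (t, u).
have [z zP] := choice wit.
have t1z i : t1 <= (z i).1 by have [/andP[+ _] _ _ _] := zP i; exact: le_trans.
have [phi [t [inc ut]]] : exists (phi : nat -> nat) (t : R),
    {homo phi : i j / (i < j)%N} /\ (fun i => (z (phi i)).1) @ \oo --> t.
  apply: (compact_subseq (u := fun i => (z i).1) (@segment_compact _ a b)) => i.
  by rewrite /= in_itv /=; have [] := zP i.
have t1t : t1 <= t.
  by apply: (cvgr_to_ge ut); apply: nearW => i; exact: t1z.
have u0 : (fun i => (z (phi i)).2) @ \oo --> (0 : R).
  apply: (@squeeze_cvgr _ _ _ _ (fun=> 0) (fun i => i.+1%:R^-1)).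
  - apply: nearW => i; have [_ -> zi _] := zP (phi i) => /=.
    rewrite -[leRHS]mul1r ler_pdivlMr ?ltr0n //; apply: le_trans zi.
    have [_ z0 _ _] := zP (phi i).
    by rewrite ler_wpM2l // ler_nat ltnS homo_ltn_leq.
  - exact: cvg_cst.
  - exact: cvg_harmonic.
have tu : (fun i => (z (phi i)).1 + (z (phi i)).2) @ \oo --> t.
  by rewrite -[t]addr0; exact: cvgD.
have t1tu i : t1 <= (z (phi i)).1 + (z (phi i)).2.
  by have [_ z0 _ _] := zP (phi i); have := t1z (phi i); lra.
have g1 : g (z (phi i)).1 @[i --> \oo] --> g t.
  exact: C0_from_seq cg (fun i => t1z (phi i)) t1t ut.
have g2 : g ((z (phi i)).1 + (z (phi i)).2) @[i --> \oo] --> g t.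
  exact: C0_from_seq cg t1tu t1t tu.
have k1 : kap (z (phi i)).1 @[i --> \oo] --> kap t.
  exact: C0_from_seq ckap (fun i => t1z (phi i)) t1t ut.
have lim0 : fro2 (g ((z (phi i)).1 + (z (phi i)).2) - g (z (phi i)).1) @[i --> \oo]
    --> fro2 (0 : 'M[R]_(m, p)).
  by apply: cvg_fro2; rewrite -(subrr (g t)); exact: cvgB.
have : kap t <= fro2 (0 : 'M[R]_(m, p)).
  apply: (ler_cvg_to k1 lim0); apply: nearW => i.
  by have [_ _ _ lt] := zP (phi i); exact: ltW.
rewrite {1}/fro2 big1 => [|i _]; last by rewrite big1 // => j _; rewrite mxE expr0n.
by apply/negP; rewrite -ltNge kap0.
Qed.

(** The geometric budgets leave a tail [e 2^-j] unspent at node [j], whence the strict bound. *)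
Lemma int_from_cells (t1 h e : R) (r : R -> R) : 0 < h -> 0 < e ->
  C0_from t1 r -> (forall t, 0 <= r t) ->
  (forall j : nat, int_from (t1 + j%:R * h) r (t1 + j%:R * h + h) <= e * 2^-1 ^+ j.+1) ->
  forall t, t1 <= t -> int_from t1 r t < e.
Proof.
move=> h0 e0 cr r0 cells.
have node (j : nat) : t1 <= t1 + j%:R * h by rewrite lerDl mulr_ge0 // ltW.
have E (j : nat) : t1 + j.+1%:R * h = t1 + j%:R * h + h.
  by rewrite -(natr1 j) mulrDl mul1r addrA.
have bnd (j : nat) : int_from t1 r (t1 + j%:R * h) <= e * (1 - 2^-1 ^+ j).
  elim: j => [|j ih]; first by rewrite mul0r addr0 int_from_id expr0 subrr mulr0.
  have := cells j; rewrite (@int_fromB _ t1) ?node //; last by rewrite lerDl ltW.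
  rewrite E exprS; lra.
move=> t t1t; have [j /andP[_ tj]] := ray_cell h0 t1t.
have := bnd j.+1; rewrite E => bj.
have : 0 <= int_from t r (t1 + j%:R * h + h) by apply: int_from_ge0.
rewrite (@int_fromB _ t1) //.
have : 0 < e * 2^-1 ^+ j.+1 by rewrite mulr_gt0 // exprn_gt0 // invr_gt0.
lra.
Qed.

End Oscillation.

(** * The causal domination, absorption and averaging functions *)

Section Stages.
Context {R : realType}.

Lemma C1_from_mx_C0 (t1 : R) m p (A : R -> 'M[R]_(m, p)) : C1_from t1 A -> C0_from t1 A.
Proof.
by move=> /C1_mxP cA; apply/C0_mxP => i j; exact: C1_from_C0.
Qed.

(** [compact_domination] is applied on each compact interval to [X = P D + P' / 2 + d P]. Of the
    three steps [h], one is for the derivative of [P] and two are for the majorant. *)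
Lemma kernel_majorant (n k l m p : nat)
    (B : R -> 'cV[R]_k -> 'M[R]_(m, p))
    (D : R -> 'cV[R]_l -> 'cV[R]_k -> 'M[R]_p)
    (yf : R -> 'cV[R]_n -> R -> 'cV[R]_k) (U W : set 'cV[R]_n)
    (L E t0 : R) (Q : R -> set 'cV[R]_l) (t1 tau0 h : R)
    (P : (R -> 'cV[R]_k) -> R -> 'M[R]_p) (d : (R -> 'cV[R]_k) -> R -> R)
    (eta : R -> R) :
  kernel_certificate B D yf U W L E t0 Q t1 tau0 P d ->
  CP t0 Q -> C1_time_output B ->
  {within [set z : R * 'cV[R]_l * 'cV[R]_k | 0 <= z.1.1],
     continuous (fun z => D z.1.1 z.1.2 z.2)} ->
  0 <= t0 -> t0 <= t1 -> 0 < h -> 0 < tau0 ->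
  C0_from t1 eta -> (forall t, t1 <= t -> 0 < eta t) ->
  exists N : (R -> 'cV[R]_k) -> R -> R,
    noncausal t0 t1 (tau0 + h + h + h) (OmegaC0 yf U t0) N /\
    forall y, OmegaC0 yf U t0 y -> C1_from t1 (N y) /\
      (OmegaC0 yf (U `&` W) t0 y -> forall t q e, t1 <= t -> Q t q ->
         qform (P y t *m D t q (y t)) e
         + 2^-1 * qform (derive_within `[t1, +oo[ (P y) t) e
         + d y t * qform (P y t) e
         <= eta t * sqn e + N y t * sqn (B t (y t) *m e)).
Proof.
move=> [cP cd H] hCP hB hD t00 t01 h0 tau00 ceta eta0.
pose X (y : R -> 'cV[R]_k) t q : 'M[R]_p := P y t *m D t q (y t)
  + 2^-1 *: derive_within `[t1, +oo[ (P y) t + d y t *: P y t.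
pose G (y : R -> 'cV[R]_k) t v := forall q e, Q t q ->
  qform (X y t q) e <= eta t * sqn e + v * sqn (B t (y t) *m e).
have XE y t q e : qform (X y t q) e = qform (P y t *m D t q (y t)) e
    + 2^-1 * qform (derive_within `[t1, +oo[ (P y) t) e + d y t * qform (P y t) e.
  by rewrite !qformD !qformZ.
have upG y t v v' : G y t v -> v <= v' -> G y t v'.
  move=> Gv vv' q e Qq; apply: le_trans (Gv q e Qq) _.
  by rewrite lerD2l ler_wpM2r // sqn_ge0.
have cG : noncausal t0 t1 (tau0 + h) (OmegaC0 yf U t0) G.
  move=> y1 y2 Y1 Y2 t t1t y12; have [[[dP _] _] _ _ _ _] := H _ Y1.
  have Peq := noncausal_eqs cP Y1 Y2 (t := t + h).
  have {}Peq s : t1 <= s -> s <= t + h -> P y1 s = P y2 s.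
    by apply: Peq => r /andP[t0r rt]; apply: y12; rewrite t0r /=; lra.
  have yt : y1 t = y2 t by apply: y12; lra.
  have dE : d y1 t = d y2 t.
    by apply: cd => // s /andP[t0s st]; apply: y12; rewrite t0s /=; lra.
  have dPE : derive_within `[t1, +oo[ (P y1) t = derive_within `[t1, +oo[ (P y2) t.
    apply: (@derive_within_local _ _ t1 (t + h)) => //; first by lra.
      exact: dP.
    by move=> s t1s st; apply: Peq => //; exact: ltW.
  have XX q : X y1 t q = X y2 t q by rewrite /X dPE dE yt Peq //; lra.
  by apply/funext => v; rewrite /G yt; apply/propext; split=> + q e Qq => /(_ q e Qq);
    rewrite XX.
have [N [cN HN]] := causal_pointwise_majorant h0 upG cG.
exists N; split=> // y Yy; have [C1N NG] := HN y Yy; split=> // Yw t q e t1t Qq.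
rewrite -XE; apply: (NG _ t t1t) => // a b t1a.
have [[C1P _] cdy _ _ ineq] := H y Yy.
have cy : C0_from t0 y by case: Yy.
suff [N0 N00 HN0] : exists2 N0, 0 <= N0 & forall r q' e', a <= r <= b -> Q r q' ->
    qform (X y r q') e' <= eta r * sqn e' + N0 * sqn (B r (y r) *m e').
  by exists N0 => // r rab s e' Qr; exact: HN0.
apply: (@compact_domination _ _ _ _ (X y) (fun t => B t (y t)) eta Q t0 t1 a b) => //.
- move=> u r s r' t1u t1s us rr'.
  have cs (V : normedModType R) (f : R -> V) : C0_from t1 f ->
      f (u i) @[i --> \oo] --> f s.
    by move=> cf; exact: C0_from_seq cf t1u t1s us.
  have cD : D (u i) (r i) (y (u i)) @[i --> \oo] --> D s r' (y s).
    have yu : y (u i) @[i --> \oo] --> y s by apply: cs; exact: C0_ray_sub cy.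
    have /subspace_continuousP/(_ (s, r', y s)) := hD.
    have s0 : 0 <= s by lra.
    move=> /(_ s0) cD A /cD; rewrite !nbhs_filterE /fmap /within /= => hA.
    have tri : (u i, r i, y (u i)) @[i --> \oo] --> (s, r', y s).
      exact: (cvg_pair (cvg_pair us rr') yu).
    have := tri _ hA; rewrite !nbhs_filterE /fmap /=; apply: filterS => i; apply.
    exact: le_trans t00 (le_trans t01 (t1u i)).
  apply: cvgD; first apply: cvgD.
  + by apply: cvg_mulmx => //; apply: cs; exact: C1_from_mx_C0.
  + by apply: cvgZr; apply: cs; exact: C1P.2.
  + by apply: cvgZ; apply: cs => //; exact: C1_from_mx_C0.
- by apply: (C0_ray_sub t01); exact: C1_time_output_mx_C0.
- move=> s r e' t1s Qr Be; rewrite XE.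
  by have := ineq Yw s e' r t1s Be Qr; lra.
Qed.

(** Cell [j] receives the budget [e 2^-(j+1)]. A causal [phi] above the number chosen for the cell
    preserves the budget because the integrand decreases in [phi]. *)
Lemma causal_absorption k (Y : set (R -> 'cV[R]_k)) (t0 t1 sg h e : R)
    (N al w : (R -> 'cV[R]_k) -> R -> R) : 0 < h -> 0 < e ->
  noncausal t0 t1 sg Y N -> noncausal t0 t1 sg Y al -> noncausal t0 t1 sg Y w ->
  (forall y, Y y -> [/\ C0_from t1 (N y), C0_from t1 (al y) & C0_from t1 (w y)]) ->
  (forall y, Y y -> [/\ forall t, t1 <= t -> 0 <= al y t, forall t, 0 <= w y t &
     {ae lebesgue_measure, forall t, t1 <= t -> al y t != 0}]) ->
  exists phi : (R -> 'cV[R]_k) -> R -> R,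
    noncausal t0 t1 (sg + h + h) Y phi /\
    forall y, Y y -> [/\ C1_from t1 (phi y), forall t, t1 <= t -> 0 <= phi y t &
      forall t, t1 <= t ->
        int_from t1 (fun s => Num.max 0 (N y s - phi y s * al y s) * w y s) t < e].
Proof.
move=> h0 e0 cN cal cw reg pos.
have node (j : nat) : t1 <= t1 + j%:R * h by rewrite lerDl mulr_ge0 // ltW.
pose f (y : R -> 'cV[R]_k) v s := Num.max 0 (N y s - v * al y s) * w y s.
pose G y (j : nat) v :=
  int_from (t1 + j%:R * h) (f y v) (t1 + j%:R * h + h) < e * 2^-1 ^+ j.+1.
have [||phi [cphi Hphi]] := @causal_majorant R t1 h h0 k Y t0 (sg + h) G.
- move=> y Yy j; have [rN ral rw] := reg y Yy; have [al0 w0 ae_al] := pos y Yy.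
  apply: int_from_absorb => //; try exact: C0_ray_sub (node j) _.
  + by move=> t jt; apply: al0; exact: le_trans jt.
  + apply: (@filterS _ _ (ae_filter_ringOfSetsType _)) ae_al => t h' jt.
    by apply: h'; exact: le_trans jt.
  + by rewrite mulr_gt0 // exprn_gt0 // invr_gt0.
- move=> y1 y2 Y1 Y2 j y12 v; rewrite /G (_ : int_from _ (f y2 v) _ =
    int_from (t1 + j%:R * h) (f y1 v) (t1 + j%:R * h + h)) //.
  apply: int_from_eq => s /andP[js sj]; have t1s := le_trans (node j) js.
  have agree r : t0 <= r <= s + sg -> y1 r = y2 r.
    by move=> /andP[t0r rs]; apply: y12; rewrite t0r /=; lra.
  by rewrite /f (cN _ _ Y1 Y2 s t1s agree) (cal _ _ Y1 Y2 s t1s agree)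
    (cw _ _ Y1 Y2 s t1s agree).
exists phi; split=> // y Yy; have [C1phi phiG] := Hphi y Yy.
have [rN ral rw] := reg y Yy; have [al0 w0 _] := pos y Yy.
have C0f (u : R -> R) : C0_from t1 u ->
    C0_from t1 (fun s => Num.max 0 (N y s - u s * al y s) * w y s).
  move=> cu; apply: C0_fromM => //; apply: C0_from_pos; apply: C0_fromD => //.
  by apply: C0_fromN; exact: C0_fromM.
split=> // [t t1t|].
  (* The nonnegative number of cell 0 is a lower bound for [phi] on the whole ray. *)
  by have [v [v0 _ /(_ t)]] := phiG 0%N; rewrite mul0r addr0 => /(_ t1t); exact: le_trans.
apply: (int_from_cells h0 e0).
- by apply: C0f; exact: C1_from_C0.
- by move=> t; rewrite mulr_ge0 // le_max lexx.
- move=> j; have [v [v0 Gv vphi]] := phiG j; apply: le_trans (ltW Gv).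
  apply: int_from_le; rewrite ?lerDl ?ltW //.
  + by apply: (C0_ray_sub (node j)); apply: C0f; exact: C1_from_C0.
  + by apply: (C0_ray_sub (node j)); apply: C0f; exact: C0_from_cst.
  + move=> s /andP[js _]; rewrite ler_wpM2r // ge_max !le_max lexx /=.
    apply/orP; right; rewrite lerD2l lerN2 ler_wpM2r //; last exact: vphi.
    by apply: al0; exact: le_trans js.
Qed.

(** The mean value theorem gives each entry its own intermediate time in the window; bounding each
    squared entry by [kap] accounts for the factor [m p]. *)
Lemma causal_average k m p (Y : set (R -> 'cV[R]_k)) (t0 t1 sg h : R)
    (g : (R -> 'cV[R]_k) -> R -> 'M[R]_(m, p)) (kap : (R -> 'cV[R]_k) -> R -> R) :
  0 < h -> noncausal t0 t1 sg Y g -> noncausal t0 t1 sg Y kap ->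
  (forall y, Y y -> [/\ C0_from t1 (g y), C0_from t1 (kap y) &
     forall t, t1 <= t -> 0 < kap y t]) ->
  exists M : (R -> 'cV[R]_k) -> R -> 'M[R]_(m, p),
    noncausal t0 t1 (sg + h + h + h) Y M /\
    forall y, Y y -> C1_from t1 (M y) /\
      forall t, t1 <= t -> fro2 (M y t - g y t) <= (m * p)%:R * kap y t.
Proof.
move=> h0 cg ckap reg.
(* The first condition keeps the window at most [h] long, which bounds the anticipation; the second
   keeps the oscillation in the window below [kap]. *)
pose G (y : R -> 'cV[R]_k) t v := h^-1 <= v /\
  forall u, 0 <= u -> u * v <= 1 -> fro2 (g y (t + u) - g y t) <= kap y t.
have upG y t v v' : G y t v -> v <= v' -> G y t v'.
  move=> [hv Gv] vv'; split=> [|u u0 uv']; first exact: le_trans vv'.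
  by apply: Gv => //; apply: le_trans uv'; rewrite ler_wpM2l.
have hi : 0 < h^-1 by rewrite invr_gt0.
have short v u : h^-1 <= v -> 0 <= u -> u * v <= 1 -> u <= h.
  move=> hv u0 uv; rewrite -[leRHS]mul1r -[leLHS](divfK (lt0r_neq0 h0)) ler_pM2r //.
  by apply: le_trans uv; rewrite ler_wpM2l.
have cG : noncausal t0 t1 (sg + h) Y G.
  have imp y1 y2 t v : Y y1 -> Y y2 -> t1 <= t ->
      (forall s, t0 <= s <= t + (sg + h) -> y1 s = y2 s) -> G y1 t v -> G y2 t v.
    move=> Y1 Y2 t1t y12 [hv Gv]; split=> // u u0 uv.
    have uh := short v u hv u0 uv.
    have agree s : s <= t + h -> forall r, t0 <= r <= s + sg -> y1 r = y2 r.
      by move=> sth r /andP[t0r rs]; apply: y12; rewrite t0r /=; lra.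
    rewrite -(cg _ _ Y1 Y2 t) //; last by apply: agree; lra.
    rewrite -(cg _ _ Y1 Y2 (t + u)) //; [|by lra|by apply: agree; lra].
    rewrite -(ckap _ _ Y1 Y2 t) //; last by apply: agree; lra.
    exact: Gv.
  move=> y1 y2 Y1 Y2 t t1t y12; apply/funext => v; apply/propext.
  by split; apply: imp => // s /y12.
have [V [cV HV]] := causal_pointwise_majorant h0 upG cG.
have VG y : Y y -> forall t, t1 <= t -> G y t (V y t).
  move=> Yy; have [_] := HV y Yy; apply => a b t1a.
  have [rg rkap kap0] := reg y Yy.
  have [v v0 vP] := oscillation_bound b rg rkap kap0 t1a.
  exists (v + h^-1); first by rewrite addr_ge0 // ltW.
  move=> t tab; split=> [|u u0 uv]; first by rewrite lerDr.
  by apply: vP => //; apply: le_trans uv; rewrite ler_wpM2l // lerDl ltW.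
have V0 y : Y y -> forall t, t1 <= t -> 0 < V y t.
  by move=> Yy t t1t; have [hv _] := VG y Yy t t1t; exact: lt_le_trans hv.
exists (fun y t => \matrix_(i, j) avg t1 (fun s => g y s i j) (V y) t); split.
  move=> y1 y2 Y1 Y2 t t1t y12; apply/matrixP => i j; rewrite !mxE /avg.
  have VE := cV _ _ Y1 Y2 t t1t y12; rewrite -VE.
  have [hv _] := VG y1 Y1 t t1t.
  have Vi : (V y1 t)^-1 <= h by rewrite -[leRHS]invrK lef_pV2 // posrE ?V0.
  have gE s : t1 <= s -> s <= t + h -> g y1 s = g y2 s.
    apply: (noncausal_eqs cg Y1 Y2) => r /andP[t0r rt].
    by apply: y12; rewrite t0r /=; lra.
  congr ((_ - _) * _); apply: int_from_eq => s /andP[t1s st]; rewrite gE //; lra.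
move=> y Yy; have [C1V _] := HV y Yy; have [rg _ _] := reg y Yy.
have rgij i j : C0_from t1 (fun s => g y s i j) by move/C0_mxP : rg.
split=> [|t t1t].
  apply/C1_mxP => i j; under eq_fun do rewrite mxE.
  by apply: C1_avg => //; exact: V0.
have [_ Gt] := VG y Yy t t1t.
rewrite /fro2 natrM mulrAC -mulrA mulr_natl.
apply: (@le_trans _ _ (\sum_(i < m) (kap y t * p%:R))); last first.
  by rewrite sumr_const card_ord mulrC.
apply: ler_sum => i _; rewrite mulr_natr.
apply: (@le_trans _ _ (\sum_(j < p) kap y t)); last by rewrite sumr_const card_ord.
apply: ler_sum => j _; rewrite !mxE.
have [u [u0 uV ->]] := avg_mean (rgij i j) (V0 y Yy) t1t.
by apply: le_trans (Gt u u0 uV); have := fro2_entry (g y (t + u) - g y t) i j; rewrite !mxE.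
Qed.

End Stages.

(** * Regularity and norms of block matrices *)

Section Blocks.
Context {R : realType}.

Lemma fro2Z m p (c : R) (A : 'M[R]_(m, p)) : fro2 (c *: A) = c ^+ 2 * fro2 A.
Proof.
rewrite /fro2 mulr_sumr; apply: eq_bigr => i _; rewrite mulr_sumr.
by apply: eq_bigr => j _; rewrite mxE exprMn.
Qed.

(** Expand [|A e - G e|^2 <= fro2 (A - G) |e|^2] and drop [|A e|^2]. *)
Lemma dotv_mulmx_ge m p (A G : 'M[R]_(m, p)) e :
  sqn (G *m e) - fro2 (A - G) * sqn e <= 2 * dotv (A *m e) (G *m e).
Proof.
have := sqn_mulmx_le (A - G) e; rewrite mulmxBl sqnD -scaleN1r sqnZ dotvZr.
have := sqn_ge0 (A *m e); lra.
Qed.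

Lemma der_from_block (t1 : R) m p (T : R -> 'M[R]_m) (S : R -> 'M[R]_(m, p))
    (S' : R -> 'M[R]_(p, m)) (P : R -> 'M[R]_p) t dT dS dS' dP : t1 <= t ->
  der_from t1 T t dT -> der_from t1 S t dS -> der_from t1 S' t dS' -> der_from t1 P t dP ->
  der_from t1 (fun s => block_mx (T s) (S s) (S' s) (P s)) t (block_mx dT dS dS' dP).
Proof.
move=> t1t /(der_from_mxP _ _ t1t) hT /(der_from_mxP _ _ t1t) hS /(der_from_mxP _ _ t1t) hS'
  /(der_from_mxP _ _ t1t) hP.
apply/der_from_mxP => // i j.
case: (split_ordP i) => i' ->; case: (split_ordP j) => j' ->.
- by rewrite block_mxEul; under eq_fun do rewrite block_mxEul; exact: hT.
- by rewrite block_mxEur; under eq_fun do rewrite block_mxEur; exact: hS.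
- by rewrite block_mxEdl; under eq_fun do rewrite block_mxEdl; exact: hS'.
- by rewrite block_mxEdr; under eq_fun do rewrite block_mxEdr; exact: hP.
Qed.

Lemma C1_block (t1 : R) m p (T : R -> 'M[R]_m) (S : R -> 'M[R]_(m, p))
    (S' : R -> 'M[R]_(p, m)) (P : R -> 'M[R]_p) :
  C1_from t1 T -> C1_from t1 S -> C1_from t1 S' -> C1_from t1 P ->
  C1_from t1 (fun s => block_mx (T s) (S s) (S' s) (P s)).
Proof.
move=> /C1_mxP hT /C1_mxP hS /C1_mxP hS' /C1_mxP hP; apply/C1_mxP => i j.
case: (split_ordP i) => i' ->; case: (split_ordP j) => j' ->.
- by under eq_fun do rewrite block_mxEul; exact: hT.
- by under eq_fun do rewrite block_mxEur; exact: hS.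
- by under eq_fun do rewrite block_mxEdl; exact: hS'.
- by under eq_fun do rewrite block_mxEdr; exact: hP.
Qed.

Lemma C1_trmx (t1 : R) m p (S : R -> 'M[R]_(m, p)) :
  C1_from t1 S -> C1_from t1 (fun s => (S s)^T).
Proof.
by move=> /C1_mxP hS; apply/C1_mxP => i j; under eq_fun do rewrite mxE; exact: hS.
Qed.

Lemma C1_scalar_mx (t1 : R) m (f : R -> R) :
  C1_from t1 f -> C1_from t1 (fun s => (f s)%:M : 'M[R]_m).
Proof.
move=> hf; apply/C1_mxP => i j; under eq_fun do rewrite mxE -mulr_natr.
by apply: (C1_fromM hf); exact: C1_from_cst.
Qed.

Lemma C1_scale_mx (t1 : R) m p (f : R -> R) (A : R -> 'M[R]_(m, p)) :
  C1_from t1 f -> C1_from t1 A -> C1_from t1 (fun s => f s *: A s).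
Proof.
move=> hf /C1_mxP hA; apply/C1_mxP => i j; under eq_fun do rewrite mxE.
by apply: (C1_fromM hf); exact: hA.
Qed.

Lemma C1_fro2 (t1 : R) m p (A : R -> 'M[R]_(m, p)) :
  C1_from t1 A -> C1_from t1 (fun s => fro2 (A s)).
Proof.
move=> /C1_mxP hA; apply: C1_from_sum => i _; apply: C1_from_sum => j _.
by under eq_fun do rewrite expr2; apply: C1_fromM; exact: hA.
Qed.

(** The shape of the full matrix at [t1], where [S] vanishes and [T] is [L] times the identity. *)
Lemma opnorm_block_diag m p (P : 'M[R]_p) (L : R) : (0 < p)%N -> 0 <= L ->
  opnorm P <= L -> opnorm (block_mx L%:M 0 0 P : 'M[R]_(m + p)) <= L.
Proof.
move=> p0 L0 /opnorm_le PL; apply/opnorm_le => //; first by rewrite addn_gt0 p0 orbT.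
move=> z; rewrite -(vsubmxK z) mul_block_col !mul0mx add0r addr0 !sqn_col.
by rewrite mul_scalar_mx sqnZ mulrDr lerD2l; exact: PL.
Qed.

End Blocks.

(** * Assembly of the full matrix and its gain *)

Theorem proposition3p1 (R : realType) (k l n n1 n2 : nat)
  (hk : (0 < k)%N) (hl : (0 < l)%N) (hn : (0 < n)%N)
  (hn1 : (0 < n1)%N) (hn2 : (0 < n2)%N)
  (A : 'cV[R]_l -> 'M[R]_n1) (C : 'cV[R]_l -> 'M[R]_(n2, n1))
  (a : R -> 'cV[R]_k -> R) (B : R -> 'cV[R]_k -> 'M[R]_(n1, n2))
  (D : R -> 'cV[R]_l -> 'cV[R]_k -> 'M[R]_n2)
  (hA : continuous A) (hC : continuous C)
  (ha : C1_time_output a) (hB : C1_time_output B)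
  (hD : {within [set z : R * 'cV[R]_l * 'cV[R]_k | 0 <= z.1.1],
           continuous (fun z => D z.1.1 z.1.2 z.2)})
  (U W : set 'cV[R]_n)
  (hU : U !=set0) (hW : W !=set0) (hUW : U `&` W !=set0)
  (yf : R -> 'cV[R]_n -> R -> 'cV[R]_k)
  (L E : R) (Q : R -> R -> set 'cV[R]_l)
  (hL : 1 < L) (hE : 0 < E)
  (h1 : forall t0 : R, 0 <= t0 ->
    CP t0 (Q t0) /\
    forall t1 tau0 : R, t0 <= t1 -> 0 < tau0 ->
    exists (P : (R -> 'cV[R]_k) -> R -> 'M[R]_n2)
           (d : (R -> 'cV[R]_k) -> R -> R),
      kernel_certificate B D yf U W L E t0 (Q t0) t1 tau0 P d)
  (h2 : forall t0 : R, 0 <= t0 -> forall y, OmegaC0 yf U t0 y ->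
    {ae lebesgue_measure, forall t : R, t0 <= t -> a t (y t) != 0}) :
  let J t q y : 'M[R]_(n1 + n2) :=
    block_mx (A q) (a t y *: B t y) (C q) (D t q y) in
  forall eps t0 t1 tau : R, 0 < eps -> 0 <= t0 -> t0 <= t1 -> 0 < tau ->
  exists (tau0 : R)
         (P : (R -> 'cV[R]_k) -> R -> 'M[R]_n2)
         (d : (R -> 'cV[R]_k) -> R -> R)
         (S : (R -> 'cV[R]_k) -> R -> 'M[R]_(n1, n2))
         (T : (R -> 'cV[R]_k) -> R -> 'M[R]_n1)
         (db : (R -> 'cV[R]_k) -> R -> R),
    let Pb y t : 'M[R]_(n1 + n2) :=
      block_mx (T y t) (S y t) (S y t)^T (P y t) in
    [/\ 0 < tau0 < tau,
        kernel_certificate B D yf U W L E t0 (Q t0) t1 tau0 P d,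
        [/\ noncausal t0 t1 tau (OmegaC0 yf U t0) S,
            noncausal t0 t1 tau (OmegaC0 yf U t0) T &
            noncausal t0 t1 tau (OmegaC0 yf U t0) db] &
        forall y, OmegaC0 yf U t0 y ->
        [/\ [/\ C1_from t1 (S y), C1_from t1 (T y),
                C1_from t1 (Pb y) & C0_from t1 (db y)],
            forall t, t1 <= t -> mxge (Pb y t) 1%:M,
            opnorm (Pb y t1) <= L,
            gain_bounds t1 (E + eps) (db y) &
            OmegaC0 yf (U `&` W) t0 y ->
            forall (t : R) (e : 'cV[R]_n2) (q : 'cV[R]_l),
              t1 <= t -> Q t0 t q ->
              let z : 'cV[R]_(n1 + n2) := col_mx 0 e in
              qform (Pb y t *m J t q (y t)) z
              + 2^-1 * qform (derive_within `[t1, +oo[ (Pb y) t) z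
              <= - db y t * qform (Pb y t) z]].
Proof.
move=> J eps t0 t1 tau eps0 t00 t01 tau_gt0.
(* Eight steps [h] are spent: three on [N], two on [phi0], three on [M]. The total anticipation is
   [tau0 + 8 h = 9 tau / 10]. *)
pose Y := OmegaC0 yf U t0; pose tau0 := tau / 2; pose h := tau / 20.
have h0 : 0 < h by rewrite divr_gt0.
have tau00 : 0 < tau0 by rewrite divr_gt0.
have [hCP hcert] := h1 t0 t00.
have [P0 [d0 cert0]] := hcert t1 tau0 t01 tau00.
have [P [d [psi [cert cpsi Hpsi]]]] := certificate_strict cert0.
have [cP cd H] := cert.
have den0 t : t1 <= t -> 0 < 1 + (t - t1) by move=> t1t; lra.
(* [2 eta] is the derivative of [eps / 4] times [clock], so its integral stays below [eps / 4]. *)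
pose eta t := eps / 8 * (1 + (t - t1)) ^- 2.
have eta0 t : t1 <= t -> 0 < eta t.
  by move=> t1t; rewrite mulr_gt0 ?divr_gt0 // invr_gt0 exprn_gt0 ?den0.
have ceta : C0_from t1 eta.
  apply: C0_fromM; first exact: C0_from_cst.
  apply: C0_fromV; first by move=> t t1t; rewrite expf_neq0 // gt_eqF ?den0.
  by apply: C0_fromM; apply: C1_from_C0; exact: C1_ray_shift.
have [N [cN HN]] := kernel_majorant cert hCP hB hD t00 t01 h0 tau00 ceta eta0.
(* With [phi = (t - t1) phi0] this gives [phi0 al = phi a^2 / 2], the usable half of the cross
   term. *)
pose al (y : R -> 'cV[R]_k) t := 2^-1 * ((t - t1) * a t (y t) ^+ 2).
pose w (y : R -> 'cV[R]_k) t := fro2 (B t (y t)).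
have outC0 y : Y y -> C0_from t1 (fun t => a t (y t)) /\ C0_from t1 (fun t => B t (y t)).
  move=> [_ cy]; split; apply: (C0_ray_sub t01).
    exact: C1_time_output_C0.
  exact: C1_time_output_mx_C0.
have pointwise sg (X : Type) (f : R -> 'cV[R]_k -> X) : 0 <= sg ->
    noncausal t0 t1 sg Y (fun y t => f t (y t)).
  by move=> sg0 y1 y2 _ _ t t1t y12; rewrite y12 // (le_trans t01 t1t) /=; lra.
have C1s : C1_from t1 (fun t => t - t1).
  by apply: C1_fromD; [exact: C1_from_id|exact: C1_from_cst].
have C0s := C1_from_C0 C1s.
have alC0 y : Y y -> C0_from t1 (al y).
  move=> Yy; have [ca _] := outC0 y Yy.
  apply: C0_fromM; first exact: C0_from_cst.
  by apply: C0_fromM => //; exact: C0_fromM.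
have wC0 y : Y y -> C0_from t1 (w y) by move=> Yy; apply: C0_fro2; case: (outC0 y Yy).
have e4 : 0 < eps / 4 by rewrite divr_gt0.
have [||||phi0 [cphi0 Hphi0]] := @causal_absorption _ _ Y t0 t1 (tau0 + h + h + h) h (eps / 4)
  N al w h0 e4 cN.
- by apply: (pointwise _ _ (fun t x => 2^-1 * ((t - t1) * a t x ^+ 2))); lra.
- by apply: (pointwise _ _ (fun t x => fro2 (B t x))); lra.
- by move=> y Yy; split; [apply: C1_from_C0; case: (HN y Yy)|exact: alC0|exact: wC0].
- move=> y Yy; split=> [t t1t|t|]; last 1 first.
  + have h2y := h2 t0 t00 y Yy.
    (* The factor [t - t1] adds only the null set of the single time [t1] to the zeros of [a]. *)
    have nt1 : {ae lebesgue_measure, forall t : R, t != t1}.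
      exists [set t1]; split=> //; first exact: lebesgue_measure_set1.
      by move=> t /= /negP; rewrite negbK => /eqP.
    apply: (@filterS2 _ _ (ae_filter_ringOfSetsType _)) h2y nt1 => t at0 tt1 t1t.
    rewrite /al mulf_neq0 // mulf_neq0 ?subr_eq0 // expf_neq0 // at0 //.
    exact: le_trans t01 t1t.
  + rewrite /al mulr_ge0 ?invr_ge0 //; apply: mulr_ge0; last exact: sqr_ge0.
    by rewrite subr_ge0.
  + exact: fro2_ge0.
pose phi (y : R -> 'cV[R]_k) t := (t - t1) * phi0 y t.
have phi_ge0 y : Y y -> forall t, t1 <= t -> 0 <= phi y t.
  by move=> Yy t t1t; have [_ p0 _] := Hphi0 y Yy; rewrite mulr_ge0 ?subr_ge0 ?p0.
have C1phi y : Y y -> C1_from t1 (phi y).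
  by move=> Yy; have [cp _ _] := Hphi0 y Yy; exact: (C1_fromM C1s cp).
pose g (y : R -> 'cV[R]_k) t := a t (y t) *: B t (y t).
pose n12 : R := (n1 * n2)%:R.
have n12_gt0 : 0 < n12 by rewrite ltr0n muln_gt0 hn1.
(* Chosen so that [phi] times the squared error of [M], at most [phi n12 kap = eta phi / (phi + 1)],
   does not exceed [eta]. *)
pose kap y t := eta t / ((phi y t + 1) * n12).
have phi1 y : Y y -> forall t, t1 <= t -> 0 < (phi y t + 1) * n12.
  by move=> Yy t t1t; rewrite mulr_gt0 // ltr_wpDl // phi_ge0.
have [|||M [cM HM]] := @causal_average _ _ _ _ Y t0 t1 (tau0 + h + h + h + h + h) h g kap h0.
- by apply: (pointwise _ _ (fun t x => a t x *: B t x)); lra.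
- move=> y1 y2 Y1 Y2 t t1t y12; rewrite /kap /phi.
  by rewrite (cphi0 _ _ Y1 Y2 t t1t y12).
- move=> y Yy; have [ca cB] := outC0 y Yy; split.
  + apply/C0_mxP => i j; under eq_fun do rewrite mxE.
    by apply: C0_fromM => //; move/C0_mxP : cB.
  + apply: C0_fromM => //; apply: C0_fromV; first by move=> t t1t; rewrite gt_eqF ?phi1.
    apply: C0_fromM; last exact: C0_from_cst.
    by apply: C0_fromD; [apply: C1_from_C0; exact: C1phi|exact: C0_from_cst].
  + by move=> t t1t; rewrite divr_gt0 ?eta0 ?phi1.
pose S (y : R -> 'cV[R]_k) t := - phi y t *: M y t.
(* The second term is [|S|^2] divided by the margin [2 s / (1 + s) psi] of [P], where [s = t - t1],
   with one factor [s] cancelled so that no division by zero occurs at [t1]. The first makes [T]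
   equal to [L] times the identity at [t1]. *)
pose wgt (y : R -> 'cV[R]_k) t := (L - 1) +
  (t - t1) * (1 + (t - t1)) * (phi0 y t * phi0 y t) * fro2 (M y t) * (2 * psi y t)^-1.
pose T (y : R -> 'cV[R]_k) t : 'M[R]_n1 := (1 + wgt y t)%:M.
pose r (y : R -> 'cV[R]_k) t := Num.max 0 (N y t - phi0 y t * al y t) * w y t.
pose db (y : R -> 'cV[R]_k) t := d y t + (- (2 * eta t) + - r y t).
have lag c : c <= 8 -> tau0 + c * h <= tau by rewrite /tau0 /h => c8; nra.
have cphi0' : noncausal t0 t1 tau Y phi0.
  by apply: noncausal_weaken cphi0; have := lag 5; rewrite /h /tau0; lra.
have cM' : noncausal t0 t1 tau Y M.
  by apply: noncausal_weaken cM; have := lag 8; rewrite /h /tau0; lra.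
have cN' : noncausal t0 t1 tau Y N.
  by apply: noncausal_weaken cN; have := lag 3; rewrite /h /tau0; lra.
have cpsi' : noncausal t0 t1 tau Y psi.
  by apply: noncausal_weaken cpsi; rewrite /tau0; lra.
have cd' : noncausal t0 t1 tau Y d.
  by apply: noncausal_weaken cd; rewrite /tau0; lra.
exists tau0, P, d, S, T, db => Pb; split=> //.
- by rewrite tau00 /tau0; lra.
- split=> y1 y2 Y1 Y2 t t1t y12.
  + by rewrite /S /phi (cphi0' _ _ Y1 Y2 t t1t y12) (cM' _ _ Y1 Y2 t t1t y12).
  + by rewrite /T /wgt (cphi0' _ _ Y1 Y2 t t1t y12) (cM' _ _ Y1 Y2 t t1t y12)
      (cpsi' _ _ Y1 Y2 t t1t y12).
  + have yt : y1 t = y2 t by apply: y12; lra.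
    by rewrite /db /r /al /w yt (cphi0' _ _ Y1 Y2 t t1t y12) (cN' _ _ Y1 Y2 t t1t y12)
      (cd' _ _ Y1 Y2 t t1t y12).
move=> y Yy.
have [[C1P symP] cdy [Pge PL] [gd1 gd2] _] := H y Yy.
have [C1psi psi0 Pstrict] := Hpsi y Yy.
have [C1N Ndom] := HN y Yy.
have [C1phi0 phi00 rlt] := Hphi0 y Yy.
have [C1M Mclose] := HM y Yy.
have rC0 : C0_from t1 (r y).
  apply: C0_fromM; last exact: wC0.
  apply: C0_from_pos; apply: C0_fromD; first exact: C1_from_C0.
  by apply: C0_fromN; apply: C0_fromM; [exact: C1_from_C0|exact: alC0].
have eC0 : C0_from t1 (fun t => 2 * eta t) by apply: C0_fromM => //; exact: C0_from_cst.
have C1S : C1_from t1 (S y) := C1_scale_mx (C1_fromN (C1phi y Yy)) C1M.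
have C1T : C1_from t1 (T y).
  have C1psi' : C1_from t1 (fun t => (2 * psi y t)^-1).
    apply: C1_fromV; first by move=> t t1t; rewrite gt_eqF // mulr_gt0 ?psi0.
    by apply: (C1_fromM _ C1psi); exact: C1_from_cst.
  have C1gain := C1_fromM (C1_fromM (C1_fromM C1s (C1_ray_shift t1))
    (C1_fromM C1phi0 C1phi0)) (C1_fro2 C1M).
  apply: C1_scalar_mx; apply: (C1_fromD (C1_from_cst _ _)).
  exact: (C1_fromD (C1_from_cst _ _) (C1_fromM C1gain C1psi')).
have C1St := C1_trmx C1S.
split.
- split=> //; first exact: C1_block.
  by apply: C0_fromD => //; apply: C0_fromD; exact: C0_fromN.
- move=> t t1t.
  have rate0 : 0 <= 2 * ((t - t1) / (1 + (t - t1)) * psi y t).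
    rewrite mulr_ge0 // mulr_ge0 ?(ltW (psi0 t t1t)) // divr_ge0 ?subr_ge0 //.
    by rewrite ltW // den0.
  apply: mxge_block (Pstrict t t1t) => //.
  + rewrite /wgt addr_ge0 //; first by lra.
    apply: mulr_ge0; last by rewrite invr_ge0 mulr_ge0 // ltW // psi0.
    apply: mulr_ge0; last exact: fro2_ge0.
    apply: mulr_ge0; last by rewrite mulr_ge0 ?phi00.
    by rewrite mulr_ge0 ?subr_ge0 // ltW // den0.
  + rewrite /S fro2Z sqrrN /phi /wgt.
    have p0 := psi0 t t1t; have dn := den0 t t1t.
    set s := t - t1 in dn *; set f := fro2 _; set p := psi y t in p0 *.
    have s0 : 0 <= s by rewrite subr_ge0.
    rewrite [leRHS](_ : _ = 2 * (s / (1 + s) * p) * (L - 1) + (s * phi0 y t) ^+ 2 * f).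
      by rewrite lerDr mulr_ge0 //; lra.
    by field; rewrite !gt_eqF.
- have -> : Pb y t1 = block_mx L%:M 0 0 (P y t1).
    rewrite /Pb /T /S /wgt /phi subrr !mul0r oppr0 scale0r trmx0 addr0.
    by rewrite addrC subrK.
  by apply: opnorm_block_diag => //; lra.
- have clk : clock t1 t1 = 0 by rewrite /clock subrr addr0 invr1 subrr.
  have dbE t : t1 <= t ->
      int_from t1 (db y) t = int_from t1 (d y) t - eps / 4 * clock t1 t - int_from t1 (r y) t.
    move=> t1t; rewrite !int_fromD //; try exact: C0_fromN; last first.
      by apply: C0_fromD; exact: C0_fromN.
    rewrite !int_fromN // (@int_from_primitive _ _ (fun s => eps / 4 * clock t1 s)
      (fun s => 2 * eta s)) //.
      by rewrite clk mulr0 subr0 addrA.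
    move=> s t1s.
    have -> : 2 * eta s = 0 * clock t1 s + eps / 4 * (1 + (s - t1)) ^- 2.
      by rewrite /eta; field; rewrite gt_eqF ?den0.
    by apply: der_fromM => //; [exact: der_from_cst|exact: der_from_clock].
  split=> [t t1t|].
    rewrite dbE //; have := gd1 t t1t; have := rlt t t1t; rewrite -/(r y).
    have := clock_lt1 t1t; nra.
  apply/cvgryPge => A0; have /cvgryPge/(_ (A0 + eps)) := gd2.
  apply: filterS2 (nbhs_pinfty_ge (num_real t1)) => t t1t IA.
  rewrite dbE //; have := rlt t t1t; rewrite -/(r y).
  have := clock_lt1 t1t; nra.
move=> Yw t e q t1t Qq; cbv zeta; set z := col_mx 0 e.
have hN := Ndom Yw t q e t1t Qq.
have -> : qform (derive_within `[t1, +oo[ (Pb y) t) z = qform (derive_within `[t1, +oo[ (P y) t) e.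
  have /der_fromE[//|_ ->] : der_from t1 (Pb y) t (block_mx (derive_within `[t1, +oo[ (T y) t)
      (derive_within `[t1, +oo[ (S y) t) (derive_within `[t1, +oo[ (fun s => (S y s)^T) t)
      (derive_within `[t1, +oo[ (P y) t)).
    apply: der_from_block => //; apply: der_from_derive_within.
    + exact: C1T.1.
    + exact: C1S.1.
    + exact: C1St.1.
    + exact: C1P.1.
  by rewrite qform_block0.
(* On [(0, e)] only the lower right block of the product counts, namely [S^T g + P D]. *)
rewrite /Pb /J mulmx_block !qform_block0 qformD qform_tmul.
have -> : S y t *m e = - phi y t *: (M y t *m e) by rewrite /S scalemxAl.
rewrite dotvZl -/(g y t).
have hM := dotv_mulmx_ge (M y t) (g y t) e.
have gB : sqn (g y t *m e) = a t (y t) ^+ 2 * sqn (B t (y t) *m e).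
  by rewrite /g -scalemxAl sqnZ.
have bw : sqn (B t (y t) *m e) <= w y t * sqn e by exact: sqn_mulmx_le.
have Pe : sqn e <= qform (P y t) e.
  by have := Pge t t1t e; rewrite qform_scalar mul1r.
have drift : phi y t * fro2 (M y t - g y t) <= eta t.
  have p0 := phi_ge0 y Yy t t1t.
  have mc : fro2 (M y t - g y t) <= n12 * kap y t := Mclose t t1t.
  apply: le_trans (ler_wpM2l p0 mc) _.
  have p1 : 0 < phi y t + 1 by rewrite ltr_wpDl.
  have -> : phi y t * (n12 * kap y t) = eta t * (phi y t / (phi y t + 1)).
    rewrite /kap; set x := phi y t in p1 *.
    by field; rewrite gt_eqF //= !pnatr_eq0 -!lt0n hn1 hn2.
  by rewrite ler_piMr ?(ltW (eta0 t t1t)) // ler_pdivrMr // mul1r lerDl.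
have hal : phi0 y t * al y t = 2^-1 * phi y t * a t (y t) ^+ 2.
  by rewrite /al /phi; ring.
have b0 := sqn_ge0 (B t (y t) *m e).
have e0 := sqn_ge0 e.
have absorb : (N y t - phi0 y t * al y t) * sqn (B t (y t) *m e) <= r y t * sqn e.
  apply: (@le_trans _ _ (Num.max 0 (N y t - phi0 y t * al y t) * sqn (B t (y t) *m e))).
    by rewrite ler_wpM2r // le_max lexx orbT.
  by rewrite /r -mulrA ler_wpM2l // le_max lexx.
have r0 : 0 <= r y t by rewrite mulr_ge0 ?fro2_ge0 // le_max lexx.
(* Replacing [g] by [M] costs [phi / 2] times its squared error, covered by a second [eta]; the
   first comes from the domination estimate. *)
have dot : - phi y t * dotv (M y t *m e) (g y t *m e) <=
    - (2^-1 * phi y t * a t (y t) ^+ 2 * sqn (B t (y t) *m e)) + eta t * sqn e.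
  have := ler_wpM2l (phi_ge0 y Yy t t1t) hM; rewrite gB.
  have := ler_wpM2r e0 drift; have := mulr_ge0 (ltW (eta0 t t1t)) e0; lra.
(* [P >= 1] turns the errors in [|e|^2] into a reduction of the gain. *)
have tail : (2 * eta t + r y t) * sqn e <= (2 * eta t + r y t) * qform (P y t) e.
  by apply: ler_wpM2l Pe; rewrite addr_ge0 // mulr_ge0 // ltW // eta0.
rewrite hal in absorb; rewrite /db; lra.
Qed.
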